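(* Let $F$ be a number field which is Galois over $\mathbb Q$, let $M$ be an even integer divisible by the discriminant of $F$, and let $\mathcal O_{F,M}=\mathcal O_F[1/M]$. Let $n\ge 1$, and let $\{1,\dots,n\}\to \mathrm{Gal}(F/\mathbb Q)$, $i\mapsto\sigma_i$, be a map with $\sigma_1=\mathrm{id}$ (a vertical gauge). Let $p$ be a prime not dividing $M$ and $\mathfrak P$ a prime of $\mathcal O_F$ dividing $p$. Let $q\in GL_n(\mathcal O_{F,M})$ with $q^t=q$. Then there exists a unique vertical connection $(\delta^1,\dots,\delta^n)$ on $G=GL_n$ at $\mathfrak P$ such that: 1) $\delta^i$ is metric with respect to $q$ for all $i=1,\dots,n$; 2) $(\delta^1,\dots,\delta^n)$ is torsion free relative to $q$.
   Context: For a matrix $a=(a_{ij})$, $a^t$ is the transpose and $a^{(p)}=(a_{ij}^p)$; set maps between rings are applied to matrices entrywise. A Frobenius lift on a ring $A$ is a ring endomorphism reducing mod $p$ to the $p$-power Frobenius of $A/pA$. All rings below are $p$-torsion free; on such a ring a $p$-derivation $\delta$ is the same thing as a Frobenius lift $\phi$, via $\phi(a)=a^p+p\,\delta a$ ($\phi$ and $\delta$ are said to be attached to each other). $\widehat{\ }$ denotes $p$-adic completion. Set $\mathfrak P_i=\sigma_i\mathfrak P$ and let $R_i=\widehat{\mathcal O_{\mathfrak P_i}}$ be the $p$-adic completion of the localization of $\mathcal O_F$ at $\mathfrak P_i$: a complete discrete valuation ring with maximal ideal generated by the odd prime $p$ and perfect residue field. It has a unique Frobenius lift, denoted $\phi^i$,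 hence a unique $p$-derivation, denoted $\delta^i$. Let $x$ be an $n\times n$ matrix of indeterminates, $G^i=\mathrm{Spec}\,R_i[x,\det(x)^{-1}]$, and $\mathcal O(\widehat{G^i})=R_i[x,\det(x)^{-1}]^{\widehat{\ }}$. The automorphism $\sigma_i$ induces an isomorphism $R_1\to R_i$, extended to an isomorphism $\sigma_i:\mathcal O(\widehat{G^1})\to\mathcal O(\widehat{G^i})$ with $\sigma_i(x)=x$. A $p$-adic connection on $G^i$ is a $p$-derivation on $\mathcal O(\widehat{G^i})$ extending the $p$-derivation of $R_i$. A vertical connection on $G$ at $\mathfrak P$ is an $n$-tuple $(\delta^1,\dots,\delta^n)$ where $\delta^i$ is a $p$-adic connection on $G^i$; the attached Frobenius lifts on $\mathcal O(\widehat{G^i})$ are again denoted $\phi^i$. Let $\mathcal H_q:\mathcal O(\widehat{G^i})\to \mathcal O(\widehat{G^i})$ be the (continuous) $R_i$-algebra homomorphism with $\mathcal H_q(x)=x^tqx$, and let $\phi^i_0$ be the Frobenius lift on $\mathcal O(\widehat{G^i})$ extending that of $R_i$ with $\phi^i_0(x)=x^{(p)}$. Then $\delta^i$ is metric with respect to $q$ if $\phi^i\circ\mathcal H_q=\mathcal H_q\circ\phi_0^i$ as ring endomorphisms of $\mathcal O(\widehat{G^i})$. The Christoffel symbols of the first kind of $(\delta^1,\dots,\delta^n)$ relative to $q$ are the matrices $\gamma_i=(\gamma_{ijk})_{j,k}:=(\delta^i x)^t\cdot\phi^i(q)\cdot x^{(p)}$ with entries in $\mathcal O(\widehat{G^i})$.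 The tuple is torsion free relative to $q$ if $\sigma_i^{-1}\gamma_{ijk}=\sigma_j^{-1}\gamma_{jik}$ in $\mathcal O(\widehat{G^1})$ for all $i,j,k=1,\dots,n$. *)

(* Defs.v *)
From HB Require Import structures.
From mathcomp Require Import all_boot all_order all_fingroup all_algebra all_field.
From mathcomp Require Import ring_quotient mpoly ring.
From mathcomp Require Import boolp classical_sets functions.

Set Implicit Arguments.
Unset Strict Implicit.
Unset Printing Implicit Defensive.

Import Order.TTheory GRing.Theory Num.Theory.
Local Open Scope ring_scope.

(* The ideal quotients of the library are quotients by proper ideals, so the
   p-adic completion of A is defined only when p is not invertible in A. *)
Definition nonunit (A : comNzRingType) (b : A) : Prop := forall a, b * a <> 1.

Section CoherentSequences.
Variables (A : comNzRingType) (p : nat).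

(* A sequence u with u_(k+1) = u_k mod p^k represents the element
   (u_k mod p^k)_k of the inverse limit of the rings A/p^k A. *)
Definition is_coherent : pred (nat -> A) := fun u =>
  `[< forall k, exists c, u k.+1 - u k = p%:R ^+ k * c >].

Lemma is_coherentP (u : nat -> A) :
  reflect (forall k, exists c, u k.+1 - u k = p%:R ^+ k * c) (u \in is_coherent).
Proof. exact: asboolP. Qed.

Lemma is_coherent_subring : subring_closed is_coherent.
Proof.
split.
- by apply/is_coherentP => k; exists 0; rewrite mulr0 subrr.
- move=> u v /is_coherentP hu /is_coherentP hv; apply/is_coherentP => k.
  have [[c hc] [d hd]] := (hu k, hv k); exists (c - d).
  rewrite mulrBr -hc -hd.
  change (u k.+1 - v k.+1 - (u k - v k) = u k.+1 - u k - (v k.+1 - v k)).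
  ring.
- move=> u v /is_coherentP hu /is_coherentP hv; apply/is_coherentP => k.
  have [[c hc] [d hd]] := (hu k, hv k); exists (c * v k.+1 + u k * d).
  have -> : (u * v) k.+1 - (u * v) k =
    (u k.+1 - u k) * v k.+1 + u k * (v k.+1 - v k).
    change (u k.+1 * v k.+1 - u k * v k =
      (u k.+1 - u k) * v k.+1 + u k * (v k.+1 - v k)); ring.
  by rewrite hc hd; ring.
Qed.

HB.instance Definition _ :=
  GRing.isSubringClosed.Build (nat -> A) is_coherent is_coherent_subring.

Definition coherent_seq := {u : nat -> A | is_coherent u}.

HB.instance Definition _ := SubType.on coherent_seq.
HB.instance Definition _ := Choice.on coherent_seq.
HB.instance Definition _ :=
  [SubChoice_isSubComNzRing of coherent_seq by <:].

Lemma const_is_coherent (a : A) : is_coherent (fun=> a).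
Proof. by apply/is_coherentP => k; exists 0; rewrite mulr0 subrr. Qed.

Definition const_seq (a : A) : coherent_seq :=
  exist (fun u => is_coherent u) _ (const_is_coherent a).

Lemma const_seq_zmod_morphism : zmod_morphism const_seq.
Proof. by move=> a b; apply: val_inj. Qed.

Lemma const_seq_monoid_morphism : monoid_morphism const_seq.
Proof. by split=> [|a b]; apply: val_inj. Qed.

HB.instance Definition _ :=
  GRing.isZmodMorphism.Build A coherent_seq const_seq const_seq_zmod_morphism.
HB.instance Definition _ :=
  GRing.isMonoidMorphism.Build A coherent_seq const_seq
    const_seq_monoid_morphism.

End CoherentSequences.

Section Completion.
Variables (A : comNzRingType) (p : nat) (pA : nonunit (p%:R : A)).

Definition null_seq (_ : nonunit (p%:R : A)) : pred (coherent_seq A p) := fun u =>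
  `[< forall k, exists c, val u k = p%:R ^+ k * c >].

Lemma null_seqP (u : coherent_seq A p) :
  reflect (forall k, exists c, val u k = p%:R ^+ k * c) (u \in null_seq pA).
Proof. exact: asboolP. Qed.

Lemma null_seq_idealr : idealr_closed (null_seq pA).
Proof.
split.
- by apply/null_seqP => k; exists 0; rewrite mulr0.
- apply/negP => /null_seqP /(_ 1%N) [c hc]; apply: (pA (a := c)).
  by rewrite expr1 in hc; rewrite -hc.
- move=> w u v /null_seqP hu /null_seqP hv; apply/null_seqP => k.
  have [[c hc] [d hd]] := (hu k, hv k); exists (val w k * c + d).
  change (val w k * val u k + val v k = p%:R ^+ k * (val w k * c + d)).
  by rewrite hc hd; ring.
Qed.

HB.instance Definition _ :=
  isIdealr.Build (coherent_seq A p) (null_seq pA) null_seq_idealr.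

Definition null_ideal : idealr (coherent_seq A p) := null_seq pA.

Definition padic_completion := {ideal_quot null_ideal}.

HB.instance Definition _ := GRing.ComNzRing.on padic_completion.

Definition to_completion (a : A) : padic_completion :=
  \pi_(padic_completion)%qT (const_seq p a).

Lemma to_completion_zmod_morphism : zmod_morphism to_completion.
Proof. by move=> a b; rewrite /to_completion !rmorphB. Qed.

Lemma to_completion_monoid_morphism : monoid_morphism to_completion.
Proof. by split=> [|a b]; rewrite /to_completion ?rmorph1 // !rmorphM. Qed.

HB.instance Definition _ :=
  GRing.isZmodMorphism.Build A padic_completion to_completion
    to_completion_zmod_morphism.
HB.instance Definition _ :=
  GRing.isMonoidMorphism.Build A padic_completion to_completion
    to_completion_monoid_morphism.

Lemma completion_nonunit : nonunit (p%:R : padic_completion).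
Proof.
move=> a; rewrite -[a]reprK; set u := generic_quotient.repr a => /eqP h.
have : p%:R * u - 1 \in null_seq pA.
  rewrite Quotient.idealrBE rmorphM rmorph_nat rmorph1 //.
move=> /null_seqP /(_ 1%N) [c].
rewrite expr1.
have -> : val (p%:R * u - 1) 1%N =
    val (p%:R : coherent_seq A p) 1%N * val u 1%N - 1 by [].
have -> : val (p%:R : coherent_seq A p) 1%N = p%:R.
  by rewrite -(rmorph_nat (@const_seq A p)).
move=> hc; apply: (pA (a := val u 1%N - c)).
by rewrite mulrBr -hc opprB addrCA subrr addr0.
Qed.

End Completion.

Section PrincipalIdeal.
Variables (B : comNzRingType) (b : B) (hb : nonunit b).

Definition multiples (_ : nonunit b) : pred B := fun h => `[< exists g, h = b * g >].

Lemma multiplesP h : reflect (exists g, h = b * g) (h \in multiples hb).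
Proof. exact: asboolP. Qed.

Lemma multiples_idealr : idealr_closed (multiples hb).
Proof.
split.
- by apply/multiplesP; exists 0; rewrite mulr0.
- by apply/negP => /multiplesP [g /esym /hb].
- move=> a u v /multiplesP [g ->] /multiplesP [h ->]; apply/multiplesP.
  by exists (a * g + h); ring.
Qed.

HB.instance Definition _ := isIdealr.Build B (multiples hb) multiples_idealr.

Definition principal_ideal : idealr B := multiples hb.

End PrincipalIdeal.

Section GL.
Variables (R : comNzRingType) (m : nat).

Definition generic_mx : 'M[{mpoly R[m * m]}]_m :=
  \matrix_(i, j) 'X_(mxvec_index i j).

Definition det_relation : {poly {mpoly R[m * m]}} :=
  (\det generic_mx)%:P * 'X - 1.

(* Evaluation at the point x = 1 of GL_m, T = 1. *)
Definition eval_at_1 (g : {poly {mpoly R[m * m]}}) : R :=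
  (map_poly (meval (fun k => mxvec (1%:M : 'M[R]_m) ord0 k)) g).[1].

Lemma eval_at_1M g h : eval_at_1 (g * h) = eval_at_1 g * eval_at_1 h.
Proof. by rewrite /eval_at_1 rmorphM hornerM. Qed.

Lemma eval_at_1B g h : eval_at_1 (g - h) = eval_at_1 g - eval_at_1 h.
Proof. by rewrite /eval_at_1 rmorphB hornerD hornerN. Qed.

Lemma eval_at_1_nat k : eval_at_1 k%:R = k%:R.
Proof. by rewrite /eval_at_1 rmorph_nat -polyC_natr hornerC. Qed.

Lemma eval_at_1_relation : eval_at_1 det_relation = 0.
Proof.
rewrite eval_at_1B eval_at_1M (eval_at_1_nat 1) /eval_at_1.
rewrite map_polyC map_polyX hornerC hornerX mulr1 /=.
rewrite -det_map_mx; apply/eqP; rewrite subr_eq0; apply/eqP.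
rewrite -[RHS](det1 R m); congr (\det _).
by apply/matrixP => i j; rewrite !mxE /= mevalXU mxvecE !mxE.
Qed.

Lemma det_relation_nonunit : nonunit det_relation.
Proof.
move=> g /(congr1 eval_at_1); rewrite eval_at_1M eval_at_1_relation mul0r.
by move/eqP; rewrite (eval_at_1_nat 1) eq_sym oner_eq0.
Qed.

(* R[x, det(x)^-1], as R[x][T] / (det(x) T - 1). *)
Definition GL_ring := {ideal_quot (principal_ideal det_relation_nonunit)}.

HB.instance Definition _ := GRing.ComNzRing.on GL_ring.

Definition GL_const (r : R) : GL_ring := \pi_(GL_ring)%qT (r%:MP)%:P.

Definition GL_mx : 'M[GL_ring]_m :=
  map_mx (fun f => \pi_(GL_ring)%qT f%:P) generic_mx.

Lemma GL_ring_nonunit p : nonunit (p%:R : R) -> nonunit (p%:R : GL_ring).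
Proof.
move=> pR a; rewrite -[a]reprK; set g := generic_quotient.repr a => /eqP h.
have : p%:R * g - 1 \in multiples det_relation_nonunit.
  by rewrite Quotient.idealrBE rmorphM rmorph_nat rmorph1.
move=> /multiplesP [u] /(congr1 eval_at_1).
rewrite eval_at_1B !eval_at_1M eval_at_1_relation mul0r !(eval_at_1_nat).
rewrite (eval_at_1_nat 1) => /eqP; rewrite subr_eq0 => /eqP; exact: pR.
Qed.

End GL.

Section RingOfIntegers.
Variable F : splittingFieldType rat.

Definition is_integral : pred F := fun x => `[< integralOver (intr : int -> F) x >].

Lemma is_integralP (x : F) :
  reflect (integralOver (intr : int -> F) x) (x \in is_integral).
Proof. exact: asboolP. Qed.

Lemma is_integral_subring : subring_closed is_integral.
Proof.
split.
- by apply/is_integralP; apply: integral1.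
- move=> x y /is_integralP hx /is_integralP hy; apply/is_integralP.
  exact: integral_sub.
- move=> x y /is_integralP hx /is_integralP hy; apply/is_integralP.
  exact: integral_mul.
Qed.

HB.instance Definition _ :=
  GRing.isSubringClosed.Build F is_integral is_integral_subring.

Definition OF := {x : F | is_integral x}.

HB.instance Definition _ := SubType.on OF.
HB.instance Definition _ := Choice.on OF.
HB.instance Definition _ := [SubChoice_isSubComNzRing of OF by <:].

Definition integral_basis (b : 'I_(\dim {:F}) -> OF) : Prop :=
  forall x : OF, exists! c : {ffun 'I_(\dim {:F}) -> int}, x = \sum_i b i *~ c i.

(* galTrace is the trace of F over Q because F is Galois over Q. *)
Definition is_discriminant (d : int) : Prop :=
  exists b, integral_basis b /\
    d%:~R = \det (\matrix_(i, j) galTrace 1 {:F} (val (b i) * val (b j))).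

Definition in_OFM (M : int) (x : F) : Prop := exists k, M%:~R ^+ k * x \in is_integral.

Definition GL_OFM (M : int) m (q : 'M[F]_m) : Prop :=
  (forall i j, in_OFM M (q i j)) /\
  exists r : 'M[F]_m,
    [/\ forall i j, in_OFM M (r i j), q *m r = 1%:M & r *m q = 1%:M].

Lemma gal_is_integral (s : gal_of {:F}) (x : F) : is_integral x -> is_integral (s x).
Proof.
move=> /is_integralP [f fmon fx]; apply/is_integralP; exists f => //.
have -> : map_poly (intr : int -> F) f = map_poly s (map_poly intr f).
  by rewrite -map_poly_comp; apply: eq_map_poly => z /=; rewrite rmorph_int.
by rewrite fmorph_root.
Qed.

Definition gal_OF (s : gal_of {:F}) (x : OF) : OF :=
  exist (fun y => is_integral y) (s (val x)) (gal_is_integral s (valP x)).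

Lemma gal_OFK s : cancel (gal_OF s) (gal_OF s^-1%g).
Proof.
move=> x; apply: val_inj => /=.
by rewrite -galM ?memvf // mulgV gal_id.
Qed.

Lemma gal_OFVK s : cancel (gal_OF s^-1%g) (gal_OF s).
Proof. by move=> x; have := gal_OFK s^-1%g x; rewrite invgK. Qed.

Lemma gal_OF_zmod_morphism s : zmod_morphism (gal_OF s).
Proof. by move=> x y; apply: val_inj; rewrite /= rmorphB. Qed.

Lemma gal_OF_monoid_morphism s : monoid_morphism (gal_OF s).
Proof. by split=> [|x y]; apply: val_inj; rewrite /= ?rmorph1 ?rmorphM. Qed.

HB.instance Definition _ s :=
  GRing.isZmodMorphism.Build OF OF (gal_OF s) (gal_OF_zmod_morphism s).
HB.instance Definition _ s :=
  GRing.isMonoidMorphism.Build OF OF (gal_OF s) (gal_OF_monoid_morphism s).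

Record prime_over (p : nat) := PrimeOver {
  over_ideal : prime_idealr OF;
  over_p : p%:R \in over_ideal }.

Section GaloisAction.
Variables (s : gal_of {:F}) (I : prime_idealr OF).

Definition gal_image : pred OF :=
  fun y => `[< exists2 x, x \in I & gal_OF s x = y >].

Lemma gal_imageE y : (y \in gal_image) = (gal_OF s^-1%g y \in I).
Proof.
apply/asboolP/idP => [[x xI <-]|yI]; first by rewrite gal_OFK.
by exists (gal_OF s^-1%g y) => //; rewrite gal_OFVK.
Qed.

Lemma gal_image_idealr : idealr_closed gal_image.
Proof.
split; rewrite ?gal_imageE ?rmorph0 ?rmorph1 ?rpred0 ?idealr1 //.
move=> a u v; rewrite !gal_imageE rmorphD rmorphM => uI vI.
by rewrite rpredD // idealMr.
Qed.

Lemma gal_image_prime : prime_idealr_closed gal_image.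
Proof. by move=> u v; rewrite !gal_imageE rmorphM prime_idealrM. Qed.

HB.instance Definition _ := isIdealr.Build OF gal_image gal_image_idealr.
HB.instance Definition _ := isPrimeIdealrClosed.Build OF gal_image gal_image_prime.

Definition gal_ideal : prime_idealr OF := gal_image.

End GaloisAction.

Lemma gal_over_p p s (P : prime_over p) : p%:R \in gal_ideal s (over_ideal P).
Proof. by rewrite [_ \in _]gal_imageE rmorph_nat over_p. Qed.

Definition gal_prime p s (P : prime_over p) : prime_over p :=
  PrimeOver (gal_over_p s P).

Section Localization.
Variables (p : nat) (P : prime_over p).

Definition in_loc : pred F := fun x =>
  `[< exists a s : OF, s \notin over_ideal P /\ x = val a / val s >].

Lemma in_locP (x : F) :
  reflect (exists a s : OF, s \notin over_ideal P /\ x = val a / val s)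
    (x \in in_loc).
Proof. exact: asboolP. Qed.

Lemma notin_neq0 (s : OF) : s \notin over_ideal P -> val s != 0.
Proof.
by apply: contra => /eqP s0; have -> : s = 0 by [apply: val_inj]; rewrite rpred0.
Qed.

Lemma in_loc_subring : subring_closed in_loc.
Proof.
split.
- apply/in_locP; exists 1, 1; split; last by rewrite divr1.
  by rewrite idealr1.
- move=> x y /in_locP [a [s [sP ->]]] /in_locP [b [t [tP ->]]]; apply/in_locP.
  exists (a * t - b * s), (s * t); split; first by rewrite prime_idealrM negb_or sP.
  have [s0 t0] := (notin_neq0 sP, notin_neq0 tP).
  rewrite [val (_ - _)]rmorphB !rmorphM /=.
  by field; rewrite s0 t0.
- move=> x y /in_locP [a [s [sP ->]]] /in_locP [b [t [tP ->]]]; apply/in_locP.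
  exists (a * b), (s * t); split; first by rewrite prime_idealrM negb_or sP.
  by rewrite !rmorphM /= invfM mulrACA.
Qed.

HB.instance Definition _ :=
  GRing.isSubringClosed.Build F in_loc in_loc_subring.

Definition localization := {x : F | in_loc x}.

HB.instance Definition _ := SubType.on localization.
HB.instance Definition _ := Choice.on localization.
HB.instance Definition _ := [SubChoice_isSubComNzRing of localization by <:].

Lemma localization_nonunit : nonunit (p%:R : localization).
Proof.
case=> x xloc /(congr1 val); have /in_locP [a [s [sP xE]]] := xloc.
rewrite rmorphM rmorph_nat rmorph1 /= xE mulrA => /eqP.
have s0 := notin_neq0 sP; rewrite -(inj_eq (mulIf s0)) mulfVK // mul1r => /eqP sE.
case/negP: sP; have -> : s = a * p%:R.
  by apply: val_inj; rewrite rmorphM rmorph_nat mulrC.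
by rewrite idealMr // over_p.
Qed.

(* x itself if x lies in the localization, 0 otherwise. *)
Definition to_loc (x : F) : localization := insubd 0 x.

(* On O_F[1/M], with p not dividing M, to_loc is the inclusion. *)
Lemma to_locK (M : int) (x : F) :
  prime p -> ~~ (p%:Z %| M)%Z -> in_OFM M x -> val (to_loc x) = x.
Proof.
move=> p_pr pM [k kx]; rewrite val_insubd; case: ifPn => // /negP[].
apply/in_locP; exists (exist (fun y => is_integral y) _ kx), (M%:~R ^+ k).
have MP : M%:~R \notin over_ideal P.
  apply/negP => MP; have cop : coprimez p M.
    by rewrite coprimezE prime_coprime // -dvdzE.
  have [[u v] /= uv] := coprimezP _ _ cop.
  have := idealr1 (over_ideal P).
  have -> : 1 = u%:~R * p%:R + v%:~R * M%:~R :> OF.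
    by rewrite -[p%:R]/(p%:Z%:~R) -!intrM -intrD uv.
  by rewrite rpredD // idealMr // over_p.
have MkP : M%:~R ^+ k \notin over_ideal P.
  elim: k {kx} => [|k IH]; first by rewrite expr0 idealr1.
  by rewrite exprS prime_idealrM negb_or MP.
split => //; have := notin_neq0 MkP; rewrite rmorphXn rmorph_int /= => M0.
by rewrite mulrC mulKf.
Qed.

Definition Rhat := padic_completion localization_nonunit.

HB.instance Definition _ := GRing.ComNzRing.on Rhat.

Lemma Rhat_nonunit : nonunit (p%:R : Rhat).
Proof. exact: completion_nonunit. Qed.

Variable m : nat.

(* The coordinate ring of the p-adic completion of GL_m over Rhat. *)
Definition Ohat := padic_completion (@GL_ring_nonunit Rhat m p Rhat_nonunit).

HB.instance Definition _ := GRing.ComNzRing.on Ohat.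

Definition Rhat_to_Ohat (a : Rhat) : Ohat := to_completion _ (GL_const m a).

Definition loc_to_Ohat (a : localization) : Ohat := Rhat_to_Ohat (to_completion _ a).

Definition xmx : 'M[Ohat]_m := map_mx (to_completion _) (GL_mx _ m).

Definition qmx (q : 'M[F]_m) : 'M[Ohat]_m :=
  map_mx (fun c => loc_to_Ohat (to_loc c)) q.

End Localization.

End RingOfIntegers.

Section FrobeniusLifts.
Variables (p : nat) (A : comNzRingType).

Definition frobenius_lift (phi : {rmorphism A -> A}) : Prop :=
  forall a, exists b, phi a = a ^+ p + p%:R * b.

Definition attached (delta : A -> A) (a : A) : A := a ^+ p + p%:R * delta a.

(* On a p-torsion free ring, delta satisfies the sum and product rules of a
   p-derivation iff the attached map is a ring endomorphism (which is then a
   Frobenius lift). *)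
Definition p_derivation (delta : A -> A) : Prop :=
  exists phi : {rmorphism A -> A}, forall a, phi a = attached delta a.

Definition mx_frob m (a : 'M[A]_m) : 'M[A]_m := map_mx (fun c => c ^+ p) a.

End FrobeniusLifts.

Section Connections.
Variables (F : splittingFieldType rat) (p m : nat).

Section OnePrime.
Variable P : prime_over F p.

Local Notation O := (Ohat P m).
Local Notation x := (xmx P m).

(* delta0 is the unique p-derivation of Rhat. *)
Definition padic_connection (delta : O -> O) : Prop :=
  p_derivation p delta /\
  exists delta0 : Rhat P -> Rhat P, p_derivation p delta0 /\
    forall a, delta (Rhat_to_Ohat m a) = Rhat_to_Ohat m (delta0 a).

(* Every ring homomorphism is p-adically continuous, so these two conditions
   determine H; similarly for is_phi0 and is_gal_ext. *)
Definition is_Hq (q : 'M[F]_m) (H : {rmorphism O -> O}) : Prop :=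
  (forall a, H (Rhat_to_Ohat m a) = Rhat_to_Ohat m a) /\
  map_mx H x = x^T *m qmx P q *m x.

Definition is_phi0 (phi0 : {rmorphism O -> O}) : Prop :=
  [/\ frobenius_lift p phi0,
      exists phiR : {rmorphism Rhat P -> Rhat P}, frobenius_lift p phiR /\
        forall a, phi0 (Rhat_to_Ohat m a) = Rhat_to_Ohat m (phiR a)
    & map_mx phi0 x = mx_frob p x].

Definition metric (q : 'M[F]_m) (delta : O -> O) : Prop :=
  exists H phi0 : {rmorphism O -> O},
    [/\ is_Hq q H, is_phi0 phi0
      & forall f, attached p delta (H f) = H (phi0 f)].

Definition christoffel (q : 'M[F]_m) (delta : O -> O) : 'M[O]_m :=
  (map_mx delta x)^T *m map_mx (attached p delta) (qmx P q) *m mx_frob p x.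

End OnePrime.

Variable P : prime_over F p.

Definition is_gal_ext (s : gal_of {:F})
    (S : {rmorphism Ohat P m -> Ohat (gal_prime s P) m}) : Prop :=
  (forall (a : localization P) (b : localization (gal_prime s P)),
     val b = s (val a) -> S (loc_to_Ohat m a) = loc_to_Ohat m b) /\
  map_mx S (xmx P m) = xmx (gal_prime s P) m.

Definition is_gal_ext_inv (s : gal_of {:F})
    (T : Ohat (gal_prime s P) m -> Ohat P m) : Prop :=
  exists S, [/\ is_gal_ext S, cancel S T & cancel T S].

Section Vertical.
Variables (sigma : 'I_m -> gal_of {:F}) (q : 'M[F]_m).
Variable delta : forall i, Ohat (gal_prime (sigma i) P) m ->
                           Ohat (gal_prime (sigma i) P) m.

Definition vertical_connection : Prop := forall i, padic_connection (@delta i).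

(* The Christoffel symbols are compared in the ring at P, which is the prime of
   index 1 because the first automorphism of a gauge is the identity. *)
Definition torsion_free : Prop :=
  exists T : forall i, Ohat (gal_prime (sigma i) P) m -> Ohat P m,
    (forall i, is_gal_ext_inv (@T i)) /\
    forall i j k, T i (christoffel q (@delta i) j k) =
                  T j (christoffel q (@delta j) i k).

End Vertical.

End Connections.

(* Main.v *)
(* Write Y = x^(p) and Q_i = phi^i(q), and transport everything to the ring O at
   P by the isomorphisms induced by the sigma_i. A connection delta^i is the free
   choice of the matrix D_i = delta^i x, and it is metric iff
   (Y + p D_i)^T Q_i (Y + p D_i) = (x^T q x)^(p). In terms of the Christoffel
   symbols G_i = D_i^T Q_i Y this reads
   G_i + G_i^T = C_i - p G_i (Y^T Q_i Y)^-1 G_i^T =: S_i(G), with C_i symmetric.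
   As in Riemannian geometry, this together with the torsion-free symmetry
   G_ijk = G_jik is equivalent to 2 G_ijk = S_ijk + S_jik - S_kij, except that
   the right-hand side still depends on G; but it does so only modulo p, so it
   is a p-adic contraction and has exactly one fixed point.

   The Frobenius lift of the complete local ring is induced by a Frobenius
   element of the Galois group, which is a lift because P is unramified; it is
   unique because the residue ring is perfect. *)

Require Import Defs.
From HB Require Import structures.
From mathcomp Require Import all_boot all_order all_fingroup all_algebra all_field.
From mathcomp Require Import ring_quotient mpoly ring.
From mathcomp Require Import boolp.

Set Implicit Arguments.
Unset Strict Implicit.
Unset Printing Implicit Defensive.

Import GRing.Theory.
Local Open Scope ring_scope.

(** * Divisibility by powers of p and p-adic convergence *)

Section Divisibility.
Variables (B : comNzRingType) (p : nat).
Implicit Types (a b c : B) (k : nat).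

Definition pdvd k a : Prop := exists c, a = p%:R ^+ k * c.

Lemma pdvdI k c : pdvd k (p%:R ^+ k * c).
Proof. by exists c. Qed.

Lemma pdvd1I c : pdvd 1 (p%:R * c).
Proof. by exists c; rewrite expr1. Qed.

Lemma pdvd_le k l a : (k <= l)%N -> pdvd l a -> pdvd k a.
Proof.
move=> kl [c ->]; exists (p%:R ^+ (l - k) * c).
by rewrite mulrA -exprD subnKC.
Qed.

Lemma pdvd_exp0 a : pdvd 0 a.
Proof. by exists a; rewrite mul1r. Qed.

Lemma pdvd0 k : pdvd k 0.
Proof. by exists 0; rewrite mulr0. Qed.

Lemma pdvdD k a b : pdvd k a -> pdvd k b -> pdvd k (a + b).
Proof. by move=> [c ->] [d ->]; exists (c + d); rewrite mulrDr. Qed.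

Lemma pdvdN k a : pdvd k a -> pdvd k (- a).
Proof. by move=> [c ->]; exists (- c); rewrite mulrN. Qed.

Lemma pdvdB k a b : pdvd k a -> pdvd k b -> pdvd k (a - b).
Proof. by move=> ha hb; apply: pdvdD => //; apply: pdvdN. Qed.

Lemma pdvdMl k a b : pdvd k b -> pdvd k (a * b).
Proof. by move=> [c ->]; exists (a * c); rewrite mulrCA. Qed.

Lemma pdvdMr k a b : pdvd k a -> pdvd k (a * b).
Proof. by rewrite mulrC; apply: pdvdMl. Qed.

Lemma pdvd_pM k a : pdvd k a -> pdvd k.+1 (p%:R * a).
Proof. by move=> [c ->]; exists c; rewrite mulrA exprS. Qed.

Lemma pdvd_sum (I : Type) (r : seq I) (Q : pred I) k (f : I -> B) :
  (forall i, Q i -> pdvd k (f i)) -> pdvd k (\sum_(i <- r | Q i) f i).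
Proof. by move=> hf; apply: big_ind => //; [exact: pdvd0|exact: pdvdD]. Qed.

Lemma pdvd_trans k a b c : pdvd k (a - b) -> pdvd k (b - c) -> pdvd k (a - c).
Proof. by move=> ha hb; rewrite -(subrKA b); apply: pdvdD. Qed.

Lemma pdvd_sym k a b : pdvd k (a - b) -> pdvd k (b - a).
Proof. by move=> /pdvdN; rewrite opprB. Qed.

Lemma pdvd_mul k a a' b b' :
  pdvd k (a - a') -> pdvd k (b - b') -> pdvd k (a * b - a' * b').
Proof.
move=> ha hb; have -> : a * b - a' * b' = (a - a') * b + a' * (b - b') by ring.
by apply: pdvdD; [apply: pdvdMr|apply: pdvdMl].
Qed.

Lemma pdvd_exp k a b n : pdvd k (a - b) -> pdvd k (a ^+ n - b ^+ n).
Proof.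
move=> hab; elim: n => [|n IH]; first by rewrite !expr0 subrr; apply: pdvd0.
by rewrite !exprS; apply: pdvd_mul.
Qed.

Lemma pdvd_expD a b : prime p -> pdvd 1 ((a + b) ^+ p - (a ^+ p + b ^+ p)).
Proof.
move=> p_pr; have p_gt0 := prime_gt0 p_pr.
rewrite exprDn -(prednK p_gt0) big_ord_recl big_ord_recr /= prednK //.
rewrite subn0 expr0 mulr1 bin0 mulr1n.
rewrite /bump /= add1n prednK // subnn expr0 mul1r binn mulr1n.
rewrite [X in pdvd 1 X](_ : _ =
    \sum_(i < p.-1) a ^+ (p - (1 + i)) * b ^+ (1 + i) *+ 'C(p, 1 + i));
  last by rewrite opprD addrACA subrr add0r addrK.
apply: pdvd_sum => i _.
have : (p %| 'C(p, 1 + i))%N.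
  by rewrite prime_dvd_bin //= add1n -[X in (_ < X)%N](prednK p_gt0) ltnS.
case/dvdnP=> c ->; rewrite -mulr_natr natrM mulrA mulrC.
exact: pdvd1I.
Qed.

Lemma pdvd_exp_sum (I : Type) (r : seq I) (f : I -> B) : prime p ->
  pdvd 1 ((\sum_(i <- r) f i) ^+ p - \sum_(i <- r) f i ^+ p).
Proof.
move=> p_pr; elim: r => [|i r IH].
  by rewrite !big_nil expr0n eqn0Ngt prime_gt0 // subrr; apply: pdvd0.
rewrite !big_cons; apply: pdvd_trans (pdvd_expD _ _ p_pr) _.
by rewrite opprD addrACA subrr add0r.
Qed.

(** The cofactor of [a - b] in [a ^+ p - b ^+ p] is a sum of [p] products, each congruent to
    [b ^+ p.-1] modulo [p] because [0 < k]; so [p] divides it. *)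
Lemma pdvd_exp_lift k a b : (0 < k)%N -> prime p ->
  pdvd k (a - b) -> pdvd k.+1 (a ^+ p - b ^+ p).
Proof.
move=> k0 p_pr hab; have hab1 : pdvd 1 (a - b) by apply: (pdvd_le k0).
rewrite subrXX; have [c ->] := hab.
have [d ->] : pdvd 1 (\sum_(i < p) a ^+ (p.-1 - i) * b ^+ i).
  rewrite (eq_bigr (fun i : 'I_p => a ^+ (p.-1 - i) * b ^+ i - b ^+ p.-1
    + b ^+ p.-1)); last by move=> i _; rewrite subrK.
  rewrite big_split /= sumr_const card_ord -mulr_natl.
  apply: pdvdD; last exact: pdvd1I.
  apply: pdvd_sum => i _; have {2}-> : p.-1 = (p.-1 - i + i)%N.
    by rewrite subnK // -ltnS prednK ?prime_gt0.
  rewrite exprD -mulrBl; apply: pdvdMr; exact: pdvd_exp.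
by exists (c * d); rewrite expr1 exprS; ring.
Qed.

End Divisibility.

Lemma pdvd_rmorph (p : nat) (A B : comNzRingType) (f : {rmorphism A -> B}) k a :
  pdvd p k a -> pdvd p k (f a).
Proof. by move=> [c ->]; exists (f c); rewrite rmorphM rmorphXn rmorph_nat. Qed.

Definition torsionfree (p : nat) (B : comNzRingType) : Prop :=
  forall b : B, p%:R * b = 0 -> b = 0.

Lemma torsionfree_mulI p (B : comNzRingType) (a b : B) :
  torsionfree p B -> p%:R * a = p%:R * b -> a = b.
Proof.
by move=> tf /eqP; rewrite -subr_eq0 -mulrBr => /eqP /tf /eqP; rewrite subr_eq0 => /eqP.
Qed.

(** * Separated and complete rings; fixed points of contractions *)

Section Complete.
Variables (p : nat) (B : comNzRingType).

Definition separated : Prop := forall b : B, (forall k, pdvd p k b) -> b = 0.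

Definition converges (u : nat -> B) (b : B) : Prop := forall k, pdvd p k (b - u k).

Definition coherent (u : nat -> B) : Prop := forall k, pdvd p k (u k.+1 - u k).

Definition complete : Prop :=
  separated /\ forall u, coherent u -> exists b, converges u b.

Lemma separated_eq (a b : B) : separated -> (forall k, pdvd p k (a - b)) -> a = b.
Proof. by move=> sep /sep /eqP; rewrite subr_eq0 => /eqP. Qed.

Lemma coherent_le (u : nat -> B) k l :
  coherent u -> (k <= l)%N -> pdvd p k (u l - u k).
Proof.
move=> cu /subnKC <-; elim: (l - k)%N => [|j IH].
  by rewrite addn0 subrr; apply: pdvd0.
by rewrite addnS; apply: pdvd_trans IH; apply: pdvd_le (cu _); rewrite leq_addr.
Qed.

(** The iterates of [f] from 0 form a coherent sequence in each coordinate, and the limit is fixed.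
    The index type [I] lets all entries of several matrices be solved for at once. *)
Lemma contraction_fixpoint (I : Type) (f : (I -> B) -> I -> B) :
  complete ->
  (forall k u v, (forall i, pdvd p k (u i - v i)) ->
     forall i, pdvd p k.+1 (f u i - f v i)) ->
  exists u, f u = u.
Proof.
move=> [sep lim] hf; pose u k := iter k f (fun=> 0).
have cu i : coherent (fun k => u k i).
  move=> k; elim: k i => [|k IH] i; first exact: pdvd_exp0.
  exact: hf IH i.
have [w hw] := choice (fun i => lim _ (cu i)).
exists w; apply: funext => i; apply: separated_eq => // k.
apply: (pdvd_le (leqnSn k)); apply: pdvd_trans (pdvd_sym (hw i k.+1)).
by apply: (hf k w (u k)) => j; apply: hw.
Qed.

Lemma contraction_unique (I : Type) (f : (I -> B) -> I -> B) u v :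
  separated ->
  (forall k u v, (forall i, pdvd p k (u i - v i)) ->
     forall i, pdvd p k.+1 (f u i - f v i)) ->
  f u = u -> f v = v -> u = v.
Proof.
move=> sep hf fu fv; apply: funext => i; apply: separated_eq => // k.
elim: k i => [|k IH] i; first exact: pdvd_exp0.
by rewrite -fu -fv; apply: hf.
Qed.

(** For [a = 1 + p c], an inverse is a fixed point of the contraction sending [u] to [1 - p c u]. *)
Lemma complete_unit (a : B) : complete -> pdvd p 1 (a - 1) -> exists b, a * b = 1.
Proof.
move=> cB [c ac]; have [|u hu] := contraction_fixpoint (I := unit)
  (f := fun u _ => 1 - p%:R * c * u tt) cB.
  move=> k u v uv _; rewrite opprD addrACA subrr add0r opprK addrC.
  by rewrite -mulrBr -mulrA; apply: pdvd_pM; apply: pdvdMl; apply: pdvd_sym.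
exists (u tt); rewrite -(subrK 1 a) ac expr1 mulrDl mul1r -{2}hu; ring.
Qed.

End Complete.

(** * p-adic completions *)

Lemma rmorphism_of (A B : comNzRingType) (f : A -> B) :
  zmod_morphism f -> monoid_morphism f -> exists g : {rmorphism A -> B}, g =1 f.
Proof.
move=> fB fM.
pose zf := GRing.isZmodMorphism.Build A B f fB.
pose mf := GRing.isMonoidMorphism.Build A B f fM.
pose g : {rmorphism A -> B} := HB.pack f zf mf.
by exists g.
Qed.

Lemma quotient_lift (A B : comNzRingType) (I : idealr A) (f : {rmorphism A -> B}) :
  (forall a, a \in I -> f a = 0) ->
  exists g : {rmorphism {ideal_quot I} -> B},
    forall a, g (\pi_({ideal_quot I})%qT a) = f a.
Proof.
move=> fI.
have fpi a : f (generic_quotient.repr (\pi_({ideal_quot I})%qT a)) = f a.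
  apply/eqP; rewrite -subr_eq0 -rmorphB; apply/eqP/fI.
  by rewrite Quotient.idealrBE reprK.
have [||g hg] := rmorphism_of (f := fun x : {ideal_quot I} => f (generic_quotient.repr x)).
- move=> x y /=; rewrite -[x]reprK -[y]reprK.
  by rewrite -(rmorphB (\pi_({ideal_quot I})%qT)) !fpi rmorphB.
- split=> [|x y] /=; first by rewrite -(rmorph1 (\pi_({ideal_quot I})%qT)) fpi rmorph1.
  by rewrite -[x]reprK -[y]reprK -(rmorphM (\pi_({ideal_quot I})%qT)) !fpi rmorphM.
- by exists g => a; rewrite hg.
Qed.

Section CompletionTheory.
Variables (A : comNzRingType) (p : nat) (pA : nonunit (p%:R : A)).
Local Notation Ah := (padic_completion pA).
Local Notation pi := (\pi_(Ah)%qT : coherent_seq A p -> Ah).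
Local Notation iota := (to_completion pA).

Lemma coherent_seqP (u : coherent_seq A p) : coherent p (val u).
Proof. by have /is_coherentP := valP u. Qed.

Lemma coherent_val (u : nat -> A) : coherent p u ->
  exists v : coherent_seq A p, val v = u.
Proof.
move=> cu; have hu : is_coherent p u by apply/is_coherentP.
by exists (exist (fun u => is_coherent p u) u hu).
Qed.

Lemma pi_eq0 (u : coherent_seq A p) : pi u = 0 <-> forall k, pdvd p k (val u k).
Proof.
have -> : (pi u = 0) = (u \in null_seq pA).
  rewrite -[u in RHS]subr0 Quotient.idealrBE rmorph0.
  by apply/propext; split=> [->|/eqP].
by split=> [/null_seqP|h] //; apply/null_seqP.
Qed.

Lemma val_natr n k : val (n%:R : coherent_seq A p) k = n%:R.
Proof. by rewrite -(rmorph_nat (@const_seq A p)). Qed.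

Lemma val_expn n j k : val (n%:R ^+ j : coherent_seq A p) k = n%:R ^+ j.
Proof. by rewrite -natrX val_natr natrX. Qed.

(** Reduction modulo [p ^ k] is read off the term of index [k]: if that term is divisible by
    [p ^ k], so is the whole tail, and the quotients can be chosen to form a coherent sequence
    again. *)
Lemma pdvd_pi (u : coherent_seq A p) k : pdvd p k (pi u) <-> pdvd p k (val u k).
Proof.
split=> [[x]|[a ha]].
  rewrite -[x]reprK; move: (generic_quotient.repr x) => v {x} /eqP.
  rewrite -subr_eq0 -(rmorph_nat pi) -rmorphXn -rmorphM -rmorphB => /eqP/pi_eq0/(_ k) h.
  rewrite -(subrK (p%:R ^+ k * val v k) (val u k)); apply: pdvdD; last exact: pdvdI.
  by rewrite -(val_expn p k k).
have cu := coherent_seqP u.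
have [w hw] : exists w : nat -> A, forall j, val u (k + j)%N = p%:R ^+ k * w j /\
    pdvd p j (w j.+1 - w j).
  have [c hc] := choice cu.
  (* The differences of [u] telescoped from index [k], with [p ^ k] divided out; after this shift
     [w] is coherent for its own index. *)
  pose w j := a + \sum_(i < j) p%:R ^+ i * c (k + i)%N.
  exists w => j; split.
    elim: j => [|j IH]; first by rewrite addn0 /w big_ord0 addr0.
    rewrite addnS -(subrK (val u (k + j)%N) (val u _)) hc IH /w big_ord_recr /=.
    by rewrite exprD; ring.
  by rewrite /w big_ord_recr /= addrA [X in X - _]addrC addrK; apply: pdvdI.
have [v hv] : exists v : coherent_seq A p, val v = w.
  by apply: coherent_val => j; case: (hw j).
exists (pi v); apply/eqP; rewrite -subr_eq0 -(rmorph_nat pi) -rmorphXn -rmorphM -rmorphB.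
apply/eqP/pi_eq0 => j.
rewrite [val _ j](_ : _ = val u j - p%:R ^+ k * val v j).
  rewrite hv; have [<- _] := hw j.
  by apply: pdvd_sym; apply: coherent_le => //; apply: leq_addl.
by rewrite -(val_expn p k j).
Qed.

Lemma pdvd_iota a k : pdvd p k (iota a) <-> pdvd p k a.
Proof. exact: pdvd_pi. Qed.

Lemma pi_converges (u : coherent_seq A p) : converges p (iota \o val u) (pi u).
Proof.
move=> k; rewrite /= /to_completion -rmorphB; apply/pdvd_pi.
by rewrite [val _ k](_ : _ = val u k - val u k) // subrr; apply: pdvd0.
Qed.

Lemma completion_dense (x : Ah) k : exists a, pdvd p k (x - iota a).
Proof.
by rewrite -[x]reprK; exists (val (generic_quotient.repr x) k); apply: pi_converges.
Qed.

Lemma completion_separated : separated p Ah.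
Proof.
move=> x; rewrite -[x]reprK => hx; apply/pi_eq0 => k; exact/pdvd_pi.
Qed.

(** A diagonal argument: approximations in [A] of the [k]-th terms modulo [p ^ k] are coherent,
    since divisibility can be tested in [A] by [pdvd_iota]. *)
Lemma completion_complete : complete p Ah.
Proof.
split=> [|x cx]; first exact: completion_separated.
have [a ha] := choice (fun k => completion_dense (x k) k).
have [|u hu] := coherent_val (u := a).
  move=> k; apply/pdvd_iota; rewrite rmorphB.
  apply: pdvd_trans (ha k); apply: pdvd_trans (cx k); apply: pdvd_sym.
  exact: pdvd_le (ha k.+1).
exists (pi u) => k; apply: pdvd_trans (pi_converges u k) _ => /=.
by rewrite hu; apply: pdvd_sym.
Qed.

Lemma completion_torsionfree : torsionfree p A -> torsionfree p Ah.
Proof.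
move=> tf x; rewrite -[x]reprK; set u := generic_quotient.repr x.
rewrite -(rmorph_nat pi) -rmorphM => /pi_eq0 h; apply/pi_eq0 => k.
(* One index is lost: cancelling [p] at index [k.+1] gives divisibility by [p ^ k] only, which
   passes to the term of index [k] by coherence. *)
have [c] := h k.+1; rewrite -[val _ _](_ : p%:R * val u k.+1 = _).
  rewrite exprS -mulrA => /(torsionfree_mulI tf) hc.
  have := coherent_seqP u k => /pdvdN; rewrite opprB hc => hk.
  by rewrite -(subrK (p%:R ^+ k * c) (val u k)); apply: pdvdD hk (pdvdI _ _ _).
by rewrite -(val_natr p k.+1).
Qed.

(** A coherent sequence is sent to the limit of its images; uniqueness of limits makes this a ring
    homomorphism that kills null sequences. *)
Lemma completion_lift (B : comNzRingType) (f : {rmorphism A -> B}) : complete p B ->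
  exists g : {rmorphism Ah -> B}, forall a, g (iota a) = f a.
Proof.
move=> [sep lim].
have cf (u : coherent_seq A p) : coherent p (f \o val u).
  by move=> k /=; rewrite -rmorphB; apply: pdvd_rmorph; apply: coherent_seqP.
have [l lP] := choice (fun u => lim _ (cf u)).
have hl u k : pdvd p k (l u - f (val u k)) := lP u k.
have l_uniq u b : (forall k, pdvd p k (b - f (val u k))) -> l u = b.
  move=> hb; apply: separated_eq sep _ => k.
  by apply: pdvd_trans (hl u k) _; apply: pdvd_sym.
have [||lr hlr] := rmorphism_of (f := l).
- move=> u v; apply: l_uniq => k.
  rewrite [f _](_ : _ = f (val u k) - f (val v k)); last by rewrite -rmorphB.
  rewrite (_ : _ - _ = l u - f (val u k) - (l v - f (val v k))); last by ring.
  exact: pdvdB.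
- split=> [|u v]; apply: l_uniq => k.
    rewrite [f _](_ : _ = 1) ?subrr; first exact: pdvd0.
    exact: rmorph1.
  rewrite [f _](_ : _ = f (val u k) * f (val v k)); last by rewrite -rmorphM.
  exact: pdvd_mul.
have [u /null_seqP hu|g hg] := quotient_lift (I := null_ideal pA) (f := lr).
  rewrite hlr; apply: l_uniq => k; rewrite sub0r; apply: pdvdN.
  by apply: pdvd_rmorph; apply: hu.
exists g => a; rewrite /to_completion hg hlr; apply: l_uniq => k.
by rewrite subrr; apply: pdvd0.
Qed.

(** Ring homomorphisms preserve divisibility by powers of [p], hence are continuous, and the image
    of [A] is dense. *)
Lemma completion_hom_eq (B : comNzRingType) (f g : {rmorphism Ah -> B}) :
  separated p B -> (forall a, f (iota a) = g (iota a)) -> f =1 g.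
Proof.
move=> sep fg x; apply: separated_eq sep _ => k.
have [a ha] := completion_dense x k.
apply: (@pdvd_trans _ _ _ _ (f (iota a))); first by rewrite -rmorphB; apply: pdvd_rmorph.
by rewrite fg -rmorphB; apply: pdvd_rmorph; apply: pdvd_sym.
Qed.

End CompletionTheory.

(** * The coordinate ring of GL *)

Section GLRing.
Variables (R : comNzRingType) (m : nat).
Local Notation G := (GL_ring R m).
Local Notation pi := (\pi_(G)%qT : {poly {mpoly R[m * m]}} -> G).

Lemma GL_const_morphism : exists f : {rmorphism R -> G}, f =1 @GL_const R m.
Proof.
apply: rmorphism_of; first by move=> a b; rewrite /GL_const !rmorphB.
by split=> [|a b]; rewrite /GL_const ?rmorph1 // !rmorphM.
Qed.

Lemma GL_mx_unit : exists t : G, \det (GL_mx R m) * t = 1.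
Proof.
exists (pi 'X); apply/eqP; rewrite -subr_eq0.
have -> : \det (GL_mx R m) = pi (\det (generic_mx R m))%:P.
  by rewrite -!det_map_mx -map_mx_comp.
rewrite -rmorphM -(rmorph1 pi) -rmorphB.
by rewrite -(rmorph0 pi) -Quotient.idealrBE subr0; apply/multiplesP; exists 1; rewrite mulr1.
Qed.

(** The closure rule for inverses serves to reach the adjoined variable ['X], the inverse of the
    generic determinant. *)
Lemma GL_ring_ind (Q : G -> Prop) :
  (forall a b, Q a -> Q b -> Q (a + b)) -> (forall a b, Q a -> Q b -> Q (a * b)) ->
  (forall r, Q (GL_const m r)) -> (forall i j, Q (GL_mx R m i j)) ->
  (forall a b, Q a -> a * b = 1 -> Q b) -> forall a, Q a.
Proof.
move=> QD QM QC QX QV a; rewrite -[a]reprK; move: (generic_quotient.repr a) => f {a}.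
have Q0 : Q 0 by rewrite -(rmorph0 pi); apply: (QC 0).
have Q1 : Q 1 by rewrite -(rmorph1 pi); apply: (QC 1).
have QE a k : Q a -> Q (a ^+ k).
  by move=> Qa; elim: k => [|k IH]; rewrite ?expr0 // exprS; apply: (QM).
have Qmp (g : {mpoly R[m * m]}) : Q (pi g%:P).
  elim/mpolyind: g => [|c mon g _ _ IH]; first by rewrite rmorph0.
  rewrite !rmorphD; apply: (QD _ _ _ IH).
  rewrite -mul_mpolyC !rmorphM; apply: (QM); first exact: QC.
  rewrite mpolyXE_id !rmorph_prod; apply: big_ind => [|? ?|k _]; [exact: Q1|exact: (QM)|].
  rewrite rmorphXn rmorphXn; apply: (QE); case/mxvec_indexP: k => i l.
  by have := QX i l; rewrite !mxE.
have QT : Q (pi 'X).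
  apply: (QV (pi (\det (generic_mx R m))%:P)) => //.
  apply/eqP; rewrite -rmorphM -subr_eq0 -(rmorph1 pi) -rmorphB.
  by rewrite -(rmorph0 pi) -Quotient.idealrBE subr0; apply/multiplesP; exists 1; rewrite mulr1.
elim/poly_ind: f => [|f c IH]; first by rewrite rmorph0.
by rewrite rmorphD rmorphM; apply: (QD); [apply: (QM)|apply: Qmp].
Qed.

(** Evaluating the coordinates at [g] and the adjoined inverse of the determinant at [h] kills the
    defining relation. *)
Lemma GL_ring_lift (B : comNzRingType) (f : {rmorphism R -> B}) (g : 'M[B]_m) (h : B) :
  \det g * h = 1 ->
  exists phi : {rmorphism G -> B},
    (forall r, phi (GL_const m r) = f r) /\ map_mx phi (GL_mx R m) = g.
Proof.
move=> gh; pose v k := mxvec g ord0 k.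
pose ev : {mpoly R[m * m]} -> B := mmap f v.
pose Ev (F : {poly {mpoly R[m * m]}}) : B := (map_poly ev F).[h].
have [||E EE] := rmorphism_of (f := Ev).
- by move=> F1 F2; rewrite /Ev rmorphB hornerD hornerN.
- split=> [|F1 F2]; first by rewrite /Ev rmorph1 hornerC.
  by rewrite /Ev rmorphM hornerM.
have EC c : E c%:P = ev c by rewrite EE /Ev map_polyC hornerC.
have genE : map_mx ev (generic_mx R m) = g.
  by apply/matrixP => i j; rewrite !mxE /ev mmapX mmap1U /v mxvecE.
have [F /multiplesP[F' ->]|phi hphi] := quotient_lift
  (I := principal_ideal (@det_relation_nonunit R m)) (f := E).
  rewrite rmorphM [E (det_relation _ _)]EE /Ev /det_relation rmorphB rmorphM rmorph1 /=.
  rewrite map_polyC map_polyX hornerD hornerN hornerM !hornerC hornerX /=.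
  by rewrite -det_map_mx genE gh subrr mul0r.
exists phi; split=> [r|]; first by rewrite /GL_const hphi EC /ev mmapC.
by apply/matrixP => i j; rewrite -[in RHS]genE !mxE hphi EC.
Qed.

Lemma mpoly_torsionfree p k : torsionfree p R -> torsionfree p {mpoly R[k]}.
Proof.
move=> tf f hf; apply/mpolyP => mon; rewrite mcoeff0; apply: tf.
by rewrite mulr_natl -mcoeffMn -mulr_natl hf mcoeff0.
Qed.

Lemma poly_torsionfree p (S : comNzRingType) : torsionfree p S -> torsionfree p {poly S}.
Proof.
move=> tf f hf; apply/polyP => i; rewrite coef0; apply: tf.
by rewrite mulr_natl -coefMn -mulr_natl hf coef0.
Qed.

Lemma GL_ring_torsionfree p : torsionfree p R -> torsionfree p G.
Proof.
move=> tf a; rewrite -[a]reprK; move: (generic_quotient.repr a) => f {a}.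
have tfm := mpoly_torsionfree (k := (m * m)%N) tf; have tfp := poly_torsionfree tfm.
rewrite -(rmorph_nat pi) -rmorphM -(rmorph0 pi) => /eqP.
rewrite -Quotient.idealrBE subr0 => /multiplesP[g hg].
apply/eqP; rewrite -Quotient.idealrBE subr0; apply/multiplesP.
set d := \det (generic_mx R m).
(* The constant term of det x * T - 1 is -1, so g is divisible by p, coefficient
   after coefficient. *)
have coefp_nat (e : {poly {mpoly R[m * m]}}) i : (p%:R * e)`_i = p%:R * e`_i.
  by rewrite !mulr_natl coefMn.
have gp i : exists c, g`_i = p%:R * c.
  elim: i => [|i [c hc]].
    exists (- f`_0); have /(congr1 (coefp 0)) := hg.
    rewrite /= coefp_nat /det_relation mulrBl mul1r coefB.
    rewrite -(mulrA _%:P) coefCM coefXM /= mulr0 sub0r mulrN => ->.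
    by rewrite opprK.
  exists (d * c - f`_i.+1); have /(congr1 (coefp i.+1)) := hg.
  rewrite /= coefp_nat /det_relation mulrBl mul1r coefB.
  rewrite -(mulrA _%:P) coefCM coefXM /= hc mulrBr => ->.
  by rewrite mulrCA opprB addrCA subrr addr0.
have [c hc] := choice gp; exists (\poly_(i < size g) c i); apply: (torsionfree_mulI tfp).
rewrite hg mulrCA; congr (_ * _); apply/polyP => i.
rewrite coefp_nat coef_poly.
by case: ltnP => [_|hi]; [exact: hc | rewrite mulr0 nth_default].
Qed.

End GLRing.

(** * Frobenius lifts *)

Section Frobenius.
Variable p : nat.
Hypothesis p_pr : prime p.

Lemma frobenius_liftP (A : comNzRingType) (phi : {rmorphism A -> A}) :
  frobenius_lift p phi <-> forall a, pdvd p 1 (phi a - a ^+ p).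
Proof.
split=> h a; have [c hc] := h a.
  by rewrite hc addrAC subrr add0r; apply: pdvd1I.
by exists c; rewrite -(subrK (a ^+ p) (phi a)) hc expr1 addrC.
Qed.

Lemma p_derivation_exists (A : comNzRingType) (phi : {rmorphism A -> A}) :
  frobenius_lift p phi -> exists delta : A -> A, forall a, phi a = attached p delta a.
Proof. by move=> h; have [d hd] := choice h; exists d. Qed.

Lemma p_derivation_frobenius (A : comNzRingType) (delta : A -> A)
    (phi : {rmorphism A -> A}) :
  (forall a, phi a = attached p delta a) -> frobenius_lift p phi.
Proof. by move=> h a; exists (delta a); apply: h. Qed.

Lemma pdvd_expN (B : comNzRingType) (a : B) : pdvd p 1 ((- a) ^+ p + a ^+ p).
Proof.
have := pdvd_expD (- a) a p_pr; rewrite addNr expr0n eqn0Ngt prime_gt0 //= sub0r.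
by move/pdvdN; rewrite opprK.
Qed.

Lemma pdvd_expB (B : comNzRingType) (a b : B) :
  pdvd p 1 ((a - b) ^+ p - (a ^+ p - b ^+ p)).
Proof.
apply: pdvd_trans (pdvd_expD a (- b) p_pr) _.
by rewrite opprD opprK addrACA subrr add0r; apply: pdvd_expN.
Qed.

Lemma pdvd_exp_signr (B : comNzRingType) (b : bool) :
  pdvd p 1 (((-1) ^+ b) ^+ p - (-1) ^+ b : B).
Proof.
case: b; last by rewrite /= expr0 expr1n subrr; apply: pdvd0.
by rewrite /= expr1 opprK; have := pdvd_expN (1 : B); rewrite expr1n.
Qed.

Lemma pdvd_prod (B : comNzRingType) k (I : finType) (f g : I -> B) :
  (forall i, pdvd p k (f i - g i)) -> pdvd p k (\prod_i f i - \prod_i g i).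
Proof.
move=> hfg; elim/big_rec2: _ => [|i a b _]; first by rewrite subrr; apply: pdvd0.
exact: pdvd_mul.
Qed.

Lemma pdvd_det (B : comNzRingType) m k (X Y : 'M[B]_m) :
  (forall i j, pdvd p k (X i j - Y i j)) -> pdvd p k (\det X - \det Y).
Proof.
move=> hXY; rewrite /determinant -sumrB; apply: pdvd_sum => s _.
by rewrite -mulrBr; apply: pdvdMl; apply: pdvd_prod.
Qed.

Lemma pdvd_det_frob (B : comNzRingType) m (X : 'M[B]_m) :
  pdvd p 1 (\det (mx_frob p X) - \det X ^+ p).
Proof.
apply: pdvd_sym; rewrite /determinant.
apply: pdvd_trans (pdvd_exp_sum _ _ p_pr) _.
rewrite -sumrB; apply: pdvd_sum => s _; rewrite exprMn; apply: pdvd_mul.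
  exact: pdvd_exp_signr.
rewrite -prodrXl (eq_bigr (fun i => mx_frob p X i (s i))) ?subrr; first exact: pdvd0.
by move=> i _; rewrite mxE.
Qed.

(** Modulo [p], the determinant of [Y] is the [p]-th power of the unit [\det X], and completeness
    lifts invertibility from the residue ring. *)
Lemma det_frob_unit (B : comNzRingType) m (X Y : 'M[B]_m) h : complete p B ->
  \det X * h = 1 -> (forall i j, pdvd p 1 (Y i j - X i j ^+ p)) ->
  exists h', \det Y * h' = 1.
Proof.
move=> cB Xh hXY; have [|u hu] := @complete_unit p _ (\det Y * h ^+ p) cB.
  have <- : \det X ^+ p * h ^+ p = 1 by rewrite -exprMn Xh expr1n.
  rewrite -mulrBl; apply: pdvdMr; apply: pdvd_trans (pdvd_det_frob X).
  by apply: pdvd_det => i j; rewrite mxE.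
by exists (h ^+ p * u); rewrite mulrA.
Qed.

(* The two maps agree mod p, and a congruence mod p^k on p-th powers improves
   by one factor p; perfectness lets every element be a p-th power mod p. *)
Lemma frobenius_lift_unique (B : comNzRingType) (f g : {rmorphism B -> B}) :
  separated p B -> (forall a : B, exists b, pdvd p 1 (a - b ^+ p)) ->
  frobenius_lift p f -> frobenius_lift p g -> f =1 g.
Proof.
move=> sep perf /frobenius_liftP hf /frobenius_liftP hg a.
suff H k b : pdvd p k.+1 (f b - g b).
  by apply: (separated_eq sep) => k; apply: pdvd_le (H k a).
elim: k b => [|k IH] b; first exact: pdvd_trans (hf b) (pdvd_sym (hg b)).
have [c [d]] := perf b; rewrite expr1 => hd.
have -> : b = c ^+ p + p%:R * d by rewrite -hd addrC subrK.
rewrite !rmorphD !rmorphM !rmorphXn !rmorph_nat opprD addrACA -mulrBr.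
apply: pdvdD; last exact: pdvd_pM.
exact: pdvd_exp_lift.
Qed.

(** * The completed coordinate ring of GL: density and universal property *)

Section CompletedGL.
Variables (R : comNzRingType) (m : nat) (pR : nonunit (p%:R : R)).
Local Notation Gh := (padic_completion (@GL_ring_nonunit R m p pR)).
Local Notation iota := (to_completion (@GL_ring_nonunit R m p pR)).
Local Notation cst r := (iota (GL_const m r)).
Local Notation X := (map_mx iota (GL_mx R m)).

Lemma GLhat_mx_unit : exists h, \det X * h = 1.
Proof.
have [t ht] := GL_mx_unit R m; exists (iota t).
by rewrite det_map_mx -rmorphM ht rmorph1.
Qed.

(** The generators reach only a dense subring, so the property is obtained for an approximation of
    [a] modulo [p ^ k], not for [a] itself. *)
Lemma GLhat_ind (Q : Gh -> Prop) k :
  (forall a b, Q a -> Q b -> Q (a + b)) -> (forall a b, Q a -> Q b -> Q (a * b)) ->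
  (forall r, Q (cst r)) -> (forall i j, Q (X i j)) ->
  (forall a b, Q a -> a * b = 1 -> Q b) ->
  forall a, exists2 b, Q b & pdvd p k (a - b).
Proof.
move=> QD QM QC QX QV a; have [b hb] := completion_dense a k.
exists (iota b) => //; elim/(@GL_ring_ind R m): b {hb}.
- by move=> a1 a2 h1 h2; rewrite rmorphD; apply: QD.
- by move=> a1 a2 h1 h2; rewrite rmorphM; apply: QM.
- exact: QC.
- by move=> i j; have := QX i j; rewrite mxE.
- by move=> a1 a2 h1 h12; apply: QV h1 _; rewrite -rmorphM h12 rmorph1.
Qed.

Lemma GLhat_hom_eq (B : comNzRingType) (f g : {rmorphism Gh -> B}) :
  separated p B -> (forall r, f (cst r) = g (cst r)) ->
  map_mx f X = map_mx g X -> f =1 g.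
Proof.
move=> sep fgC fgX a; apply: (separated_eq sep) => k.
have [||||a1 a2 h1 h12|b hb ab] := @GLhat_ind (fun a => f a = g a) k _ _ _ _ _ a.
- by move=> a1 a2 h1 h2; rewrite !rmorphD h1 h2.
- by move=> a1 a2 h1 h2; rewrite !rmorphM h1 h2.
- exact: fgC.
- by move=> i j; move/matrixP/(_ i j): fgX; rewrite [LHS]mxE [RHS]mxE.
- have hf : f a1 * f a2 = 1 by rewrite -rmorphM h12 rmorph1.
  have hg : f a1 * g a2 = 1 by rewrite h1 -rmorphM h12 rmorph1.
  by rewrite -[f a2]mulr1 -hg mulrA [f a2 * _]mulrC hf mul1r.
apply: (@pdvd_trans _ _ _ _ (f b)); first by rewrite -rmorphB; apply: pdvd_rmorph.
by rewrite hb -rmorphB; apply: pdvd_rmorph; apply: pdvd_sym.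
Qed.

(** Congruence of [phi a] and [a ^+ p] modulo [p] is stable under sums, products, inverses and
    changes of [a] modulo [p], so the generators decide it. *)
Lemma GLhat_frobenius (phi : {rmorphism Gh -> Gh}) :
  (forall r, pdvd p 1 (phi (cst r) - cst r ^+ p)) ->
  (forall i j, pdvd p 1 (phi (X i j) - X i j ^+ p)) -> frobenius_lift p phi.
Proof.
move=> hC hX; apply/frobenius_liftP => a.
have [||||a1 a2 h1 h12|b hb ab] :=
  @GLhat_ind (fun a => pdvd p 1 (phi a - a ^+ p)) 1 _ _ _ _ _ a.
- move=> a1 a2 h1 h2; rewrite rmorphD.
  apply: pdvd_trans (pdvd_sym (pdvd_expD a1 a2 p_pr)).
  by rewrite opprD addrACA; apply: pdvdD.
- by move=> a1 a2 h1 h2; rewrite rmorphM exprMn; apply: pdvd_mul.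
- exact: hC.
- exact: hX.
- have e1 : phi a1 * phi a2 = 1 by rewrite -rmorphM h12 rmorph1.
  have e2 : a1 ^+ p * a2 ^+ p = 1 by rewrite -exprMn h12 expr1n.
  have -> : phi a2 - a2 ^+ p = phi a2 * a2 ^+ p * (a1 ^+ p - phi a1).
    transitivity (phi a2 * (a1 ^+ p * a2 ^+ p) - phi a1 * phi a2 * a2 ^+ p); last by ring.
    by rewrite e1 e2 mulr1 mul1r.
  by apply: pdvdMl; apply: pdvd_sym.
apply: (@pdvd_trans _ _ _ _ (phi b)); first by rewrite -rmorphB; apply: pdvd_rmorph.
by apply: pdvd_trans hb _; apply: pdvd_exp; apply: pdvd_sym.
Qed.

Lemma GLhat_lift (B : comNzRingType) (f : {rmorphism R -> B}) (g : 'M[B]_m) (h : B) :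
  complete p B -> \det g * h = 1 ->
  exists phi : {rmorphism Gh -> B},
    (forall r, phi (cst r) = f r) /\ map_mx phi X = g.
Proof.
move=> cB gh; have [psi [psiC psiX]] := GL_ring_lift f gh.
have [phi hphi] := completion_lift (@GL_ring_nonunit R m p pR) psi cB.
exists phi; split=> [r|]; first by rewrite hphi psiC.
by rewrite -psiX; apply/matrixP => i j; rewrite !mxE hphi.
Qed.

End CompletedGL.

End Frobenius.

(** * The Levi-Civita equations *)

Section LeviCivita.
Variables (p m : nat) (B : comNzRingType) (half : B).
Hypotheses (cB : complete p B) (tf : torsionfree p B) (halfP : 2%:R * half = 1).
Variables (Y V : 'M[B]_m) (Q W C : 'I_m -> 'M[B]_m).
Hypotheses (YV : Y *m V = 1%:M) (VY : V *m Y = 1%:M).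
Hypotheses (QW : forall i, Q i *m W i = 1%:M) (WQ : forall i, W i *m Q i = 1%:M).
Hypotheses (Qsym : forall i, (Q i)^T = Q i) (Csym : forall i, (C i)^T = C i).

(** The two conditions after transport to one ring: [Y] stands for x^(p), [Q i] for phi^i(q),
    [p%:R *: C i] for the metric defect, and the unknown [D i] for the matrix of the connection of
    index [i]. *)
Definition levi_civita (D : 'I_m -> 'M[B]_m) : Prop :=
  (forall i, (Y + p%:R *: D i)^T *m Q i *m (Y + p%:R *: D i) =
     Y^T *m Q i *m Y + p%:R *: C i) /\
  forall i j k, ((D i)^T *m Q i *m Y) j k = ((D j)^T *m Q j *m Y) i k.

(** The inverse of [Y^T *m Q i *m Y], needed to express the quadratic term [(D i)^T *m Q i *m D i]
    through the Christoffel symbols. *)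
Let K i := V *m W i *m V^T.

Let S (G : 'I_m -> 'M[B]_m) i := C i - p%:R *: (G i *m K i *m (G i)^T).

Let first_kind (D : 'I_m -> 'M[B]_m) i := (D i)^T *m Q i *m Y.

Let Wsym i : (W i)^T = W i.
Proof.
rewrite -[LHS]mulmx1 -(QW i) mulmxA -{1}(Qsym i) -trmx_mul QW trmx1 mul1mx //.
Qed.

Let SE G i j k : S G i j k =
  C i j k - p%:R * \sum_a (\sum_b G i j b * K i b a) * G i k a.
Proof.
rewrite /S mxE [X in _ + X]mxE [X in - X]mxE [X in _ * X]mxE.
by congr (_ - _ * _); apply: eq_bigr => a _; rewrite mxE [_^T _ _]mxE.
Qed.

Let Ssym G i j k : S G i j k = S G i k j.
Proof.
suff h : (S G i)^T = S G i by rewrite -[in LHS]h mxE.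
rewrite /S linearB linearZ /= Csym /K !trmx_mul !trmxK Wsym.
by rewrite !mulmxA.
Qed.

Let scale_inj (M N : 'M[B]_m) : p%:R *: M = p%:R *: N -> M = N.
Proof.
move=> /matrixP MN; apply/matrixP => i j; apply: (torsionfree_mulI tf).
by have := MN i j; rewrite !mxE.
Qed.

(** Expanding the left side gives [Y^T *m Q i *m Y] plus [p] times [G + G^T + p G K G^T];
    torsion-freeness cancels the factor [p]. *)
Let metricP D i :
  (Y + p%:R *: D i)^T *m Q i *m (Y + p%:R *: D i) = Y^T *m Q i *m Y + p%:R *: C i <->
  first_kind D i + (first_kind D i)^T = S (first_kind D) i.
Proof.
pose G := first_kind D i.
have GT : G^T = Y^T *m Q i *m D i by rewrite /G /first_kind !trmx_mul trmxK Qsym mulmxA.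
have GK : G *m K i *m G^T = (D i)^T *m Q i *m D i.
  rewrite GT /G /first_kind /K !mulmxA -(mulmxA _ Y V) YV mulmx1.
  rewrite -(mulmxA _ V^T) -trmx_mul YV trmx1 mulmx1.
  by rewrite -(mulmxA _ (Q i) (W i)) QW mulmx1.
have -> : (Y + p%:R *: D i)^T *m Q i *m (Y + p%:R *: D i) =
    Y^T *m Q i *m Y + p%:R *: (G + G^T + p%:R *: (G *m K i *m G^T)).
  rewrite GK GT /G /first_kind [(Y + _)^T]linearD /=.
  rewrite [(p%:R *: D i)^T]linearZ /= !mulmxDl !mulmxDr.
  rewrite -!scalemxAl -!scalemxAr !scalerDr -!addrA; congr (_ + _).
  by rewrite addrCA.
rewrite -[first_kind D i]/G /S -[first_kind D i]/G; split=> [/addrI/scale_inj <-|->].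
  by rewrite addrK.
by rewrite subrK.
Qed.

Let mx_of (u : 'I_m * 'I_m * 'I_m -> B) i : 'M[B]_m := \matrix_(j, k) u (i, j, k).

(* The right-hand side of the Koszul formula, whose fixed points are the
   solutions because S G depends on G only modulo p. *)
Let koszul (u : 'I_m * 'I_m * 'I_m -> B) (t : 'I_m * 'I_m * 'I_m) : B :=
  let: (i, j, k) := t in
  half * (S (mx_of u) i j k + S (mx_of u) j i k - S (mx_of u) k i j).

Let koszul_contraction k u v : (forall t, pdvd p k (u t - v t)) ->
  forall t, pdvd p k.+1 (koszul u t - koszul v t).
Proof.
move=> uv; have hS i j l : pdvd p k.+1 (S (mx_of u) i j l - S (mx_of v) i j l).
  rewrite !SE opprD addrACA subrr add0r opprK addrC -mulrBr; apply: pdvd_pM.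
  rewrite -sumrB; apply: pdvd_sum => a _.
  apply: pdvd_mul; last by rewrite !mxE; apply: pdvd_sym.
  rewrite -sumrB; apply: pdvd_sum => b _; rewrite -mulrBl !mxE.
  exact/pdvdMr/pdvd_sym.
case=> [[i j] l]; rewrite /koszul -mulrBr; apply: pdvdMl.
rewrite [X in pdvd _ _ X](_ : _ =
  (S (mx_of u) i j l - S (mx_of v) i j l) + (S (mx_of u) j i l - S (mx_of v) j i l)
  - (S (mx_of u) l i j - S (mx_of v) l i j)); last by ring.
by apply: pdvdB => //; apply: pdvdD.
Qed.

(** Since [S] is symmetric in its last two indices, the formula is symmetric in [i] and [j], and
    adding the version with [j] and [k] exchanged leaves [S i j k]. Conversely, replacing each [S]
    by the sum it equals leaves twice [u (i, j, k)]. *)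
Let koszul_fix u : koszul u = u <->
  (forall i j k, u (i, j, k) = u (j, i, k)) /\
  (forall i j k, u (i, j, k) + u (i, k, j) = S (mx_of u) i j k).
Proof.
set s := S (mx_of u); have s_sym i j k : s i j k = s i k j by exact: Ssym.
split=> [hu|[ut us]].
  have hu' i j k : u (i, j, k) = half * (s i j k + s j i k - s k i j) by rewrite -{1}hu.
  split=> i j k; first by rewrite !hu' (s_sym k j i) [s j i k + _]addrC.
  by rewrite !hu' (s_sym i k j) -[RHS]mul1r -halfP; ring.
apply: funext => -[[i j] k]; rewrite /koszul -/s -!us.
rewrite (ut k i j) (ut k j i) (ut j i k) -[RHS]mul1r -halfP; ring.
Qed.

Let levi_civitaP D : levi_civita D <->
  koszul (fun t => first_kind D t.1.1 t.1.2 t.2) = fun t => first_kind D t.1.1 t.1.2 t.2.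
Proof.
have mxE' : mx_of (fun t => first_kind D t.1.1 t.1.2 t.2) = first_kind D.
  by apply: funext => i; apply/matrixP => j k; rewrite mxE.
rewrite koszul_fix mxE'; split=> [[hm ht]|[ht hm]]; split=> //.
- by move=> i j k /=; move/metricP: (hm i) => <-; rewrite [RHS]mxE [_^T j k]mxE.
- by move=> i; apply/metricP/matrixP => j k; rewrite -hm [LHS]mxE [_^T j k]mxE.
Qed.

(** Raising the index: this solves [G = D^T *m Q i *m Y] for [D], so solutions in Christoffel
    symbols and in matrices [D] correspond bijectively. *)
Let second_kind (u : 'I_m * 'I_m * 'I_m -> B) i := (mx_of u i *m V *m W i)^T.

Let first_second u : (fun t => first_kind (second_kind u) t.1.1 t.1.2 t.2) = u.
Proof.
apply: funext => -[[i j] k] /=; rewrite /first_kind /second_kind trmxK.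
by rewrite -[in LHS](mulmxA _ (W i)) WQ mulmx1 -mulmxA VY mulmx1 mxE.
Qed.

Let second_first D : second_kind (fun t => first_kind D t.1.1 t.1.2 t.2) = D.
Proof.
apply: funext => i; rewrite /second_kind.
have -> : mx_of (fun t => first_kind D t.1.1 t.1.2 t.2) i = first_kind D i.
  by apply/matrixP => j k; rewrite mxE.
rewrite /first_kind -(mulmxA _ Y V) YV mulmx1 -(mulmxA _ (Q i)) QW mulmx1.
exact: trmxK.
Qed.

Lemma levi_civita_exists : exists D, levi_civita D.
Proof.
have [u hu] := contraction_fixpoint cB koszul_contraction.
by exists (second_kind u); apply/levi_civitaP; rewrite first_second.
Qed.

Lemma levi_civita_unique D D' : levi_civita D -> levi_civita D' -> D = D'.
Proof.
move=> /levi_civitaP hD /levi_civitaP hD'.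
rewrite -(second_first D) -(second_first D'); congr second_kind.
exact: contraction_unique (proj1 cB) koszul_contraction hD hD'.
Qed.

End LeviCivita.

(** * Unramified primes and Frobenius elements *)

Section IntegersOfF.
Variable F : splittingFieldType rat.
Local Notation OF := (OF F).
Local Notation G := ('Gal({:F} / 1))%g.
Hypothesis galF : galois 1 {:F}.

(** In [algC], [r] becomes a rational algebraic integer, hence an integer. *)
Lemma rat_integral (r : rat) : integralOver (intr : int -> F) r%:A ->
  exists m : int, r = m%:~R.
Proof.
case=> f fmon; rewrite (_ : map_poly _ f = map_poly (in_alg F) (map_poly intr f)).
  rewrite fmorph_root -(fmorph_root (ratr : rat -> algC)) => fr.
  have : (ratr r : algC) \is a Num.int.
    apply: Cint_rat_Aint; first exact: Crat_rat.
    apply: root_monic_Aint fr _ _; first by rewrite !monic_map.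
    apply/polyOverP => i; rewrite !coef_map /= rmorph_int; exact: Num.Theory.intr_int.
  case/Num.Theory.intrP => m hm; exists m; apply: (fmorph_inj (ratr : rat -> algC)).
  by rewrite /= hm ratr_int.
rewrite -map_poly_comp; apply: eq_map_poly => m.
exact/esym/(rmorph_int (in_alg F)).
Qed.

Lemma gal_OFM s t (x : OF) : gal_OF s (gal_OF t x) = gal_OF (t * s)%g x.
Proof. by apply: val_inj; rewrite /= galM ?memvf. Qed.

Lemma gal_OF1 (x : OF) : gal_OF 1%g x = x.
Proof. by apply: val_inj; rewrite /= gal_id. Qed.

Lemma gal_fixed_int (z : OF) : (forall s, s \in G -> gal_OF s z = z) ->
  exists m : int, z = m%:~R.
Proof.
move=> hz; have : val z \in fixedField G.
  by apply/fixedFieldP; rewrite ?memvf // => s /hz /(congr1 val).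
rewrite (galois_fixedField galF) => /vlineP[r hr].
have /is_integralP := valP z; rewrite hr => /rat_integral[m hm].
by exists m; apply: val_inj; rewrite hr hm rmorph_int -[RHS](rmorph_int (in_alg F)).
Qed.

Lemma OF_intr_inj : injective (intr : int -> OF).
Proof.
move=> m n /(congr1 val); rewrite !rmorph_int -!(rmorph_int (in_alg F)).
by move/fmorph_inj/intr_inj.
Qed.

Lemma dvdz_OF (p : nat) (m : int) : (0 < p)%N -> pdvd p 1 (m%:~R : OF) -> (p %| m)%Z.
Proof.
move=> p0 [c]; rewrite expr1 => /(congr1 val).
rewrite rmorph_int rmorphM rmorph_nat /= => hc.
have /is_integralP := valP c.
have p0' : (p%:R : rat) != 0 by rewrite Num.Theory.pnatr_eq0 -lt0n.
have -> : val c = (m%:~R / p%:R)%:A.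
  rewrite -[RHS]/(in_alg F _) rmorphM fmorphV rmorph_int rmorph_nat hc mulrC mulKf //.
  by rewrite -(rmorph_nat (in_alg F)) fmorph_eq0.
case/rat_integral => n hn; apply/dvdzP; exists n; apply: (intr_inj (R := rat)).
by rewrite intrM -hn mulfVK.
Qed.

Lemma galTrace_int (z : OF) :
  exists m : int, \sum_(s in G) gal_OF s z = m%:~R.
Proof.
apply: gal_fixed_int => t tG; rewrite rmorph_sum /=.
under eq_bigr do rewrite gal_OFM.
rewrite [RHS](reindex_inj (mulIg t)) /=.
by apply: eq_bigl => s; rewrite groupMr.
Qed.

(** * The ring of integers modulo an unramified prime *)

Section Unramified.
Variables (p : nat) (M d : int).
Hypotheses (p_pr : prime p) (dF : is_discriminant F d) (dM : (d %| M)%Z).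
Hypothesis pM : ~~ (p%:Z %| M)%Z.

Let d_coprime : coprimez p d.
Proof.
rewrite coprimezE prime_coprime //; apply: contra pM => pd.
by apply: dvdz_trans dM; rewrite dvdzE.
Qed.

(* If p divides z^p then p divides the trace of every multiple of z, since the
   p-th power of the trace is the trace of the p-th power mod p; the trace form
   being nondegenerate mod p, p divides z. *)
Lemma frob_OF_inj (z : OF) : pdvd p 1 (z ^+ p) -> pdvd p 1 z.
Proof.
move=> hz; have [b [bas db]] := dF.
have tr y : exists m : int, \sum_(s in G) gal_OF s (z * y) = (p%:Z * m)%:~R.
  have [m hm] := galTrace_int (z * y).
  suff /dvdzP[c hc] : (p %| m)%Z by exists c; rewrite hm hc mulrC.
  have /(dvdz_OF (prime_gt0 p_pr)) : pdvd p 1 ((m ^+ p)%:~R : OF).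
    rewrite rmorphXn /= -hm.
    rewrite -(subrK (\sum_(s in G) gal_OF s (z * y) ^+ p) (_ ^+ p)); apply: pdvdD.
      rewrite -big_filter -[X in _ - X]big_filter; exact: pdvd_exp_sum.
    apply: pdvd_sum => s _; rewrite -rmorphXn exprMn rmorphM.
    exact/pdvdMr/pdvd_rmorph.
  rewrite !dvdzE abszX /= Euclid_dvdX //; by case/andP.
have [t ht] := choice (fun j => tr (b j)).
have [T hT] := choice (fun ij : _ * _ => galTrace_int (b ij.1 * b ij.2)).
pose TM := \matrix_(i, j) T (i, j).
have dT : d = \det TM.
  apply: (intr_inj (R := rat)); apply: (fmorph_inj (in_alg F)).
  rewrite !rmorph_int db -(det_map_mx (intr : int -> F)); congr (\det _).
  apply/matrixP => i j; rewrite !mxE /galTrace.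
  have /(congr1 val) := hT (i, j); rewrite rmorph_int /= => <-.
  by rewrite [RHS](rmorph_sum (val : OF -> F)); apply: eq_bigr => s _; rewrite /= rmorphM.
have [c [hc _]] := bas z.
pose cv := \row_i c i.
have cT : cv *m TM = p%:Z *: \row_j t j.
  apply/rowP => j; rewrite !mxE; apply: OF_intr_inj.
  rewrite -ht hc rmorph_sum /=.
  transitivity (\sum_i \sum_(s in G) gal_OF s (b i * b j) *~ c i).
    apply: eq_bigr => i _; rewrite !mxE rmorphM /= -mulrz_suml.
    by rewrite mulrC mulrzr -(hT (i, j)).
  rewrite exchange_big; apply: eq_bigr => s _.
  rewrite mulr_suml rmorph_sum; apply: eq_bigr => i _.
  by rewrite mulrzAl rmorphMz.
(* Cramer's rule: [TM] has determinant [d], so its adjugate shows that [p] divides [d * c i], and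
   [p] is coprime to [d]. *)
have pc i : (p %| c i)%Z.
  rewrite -(Gauss_dvdzr _ d_coprime).
  have : cv *m TM *m \adj TM = d *: cv by rewrite -mulmxA mul_mx_adj -dT mul_mx_scalar.
  rewrite cT -scalemxAl => /rowP/(_ i); rewrite !mxE => <-.
  exact: dvdz_mulr.
rewrite hc; apply: pdvd_sum => i _; have /dvdzP[e ->] := pc i.
by exists (b i *~ e); rewrite expr1 mulrzA mulr_natl pmulrn.
Qed.


(** Coordinates in an integral basis reduced modulo [p] take finitely many values. *)
Lemma OF_pigeonhole (x : OF) :
  exists i j, (i < j)%N /\ pdvd p 1 (x ^+ (p ^ j) - x ^+ (p ^ i)).
Proof.
have [b [bas _]] := dF; have p0 := prime_gt0 p_pr.
have [c hc] := choice (fun y => bas y).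
pose T := {ffun 'I_(\dim {:F}) -> 'I_p}.
have red_lt (m : int) : (`|(m %% p)%Z| < p)%N.
  by rewrite -ltz_nat gez0_abs ?modz_ge0 ?ltz_pmod // ?ltz_nat // -lt0n.
pose red y : T := [ffun i => Ordinal (red_lt (c y i))].
have red_eq y z : red y = red z -> pdvd p 1 (y - z).
  move=> /ffunP yz; rewrite (proj1 (hc y)) (proj1 (hc z)) -sumrB.
  apply: pdvd_sum => i _; rewrite -mulrzBr.
  have : (c y i == c z i %[mod p])%Z.
    have /(congr1 val) := yz i; rewrite !ffunE /= => /(congr1 Posz).
    by rewrite !gez0_abs ?modz_ge0 // -?lt0n // => ->.
  rewrite eqz_mod_dvd => /dvdzP[e ->].
  by exists (b i *~ e); rewrite expr1 mulrzA mulr_natl pmulrn.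
pose f (k : 'I_(#|T|.+1)) := red (x ^+ (p ^ k)).
have /injectivePn[i [j ij fij]] : ~~ injectiveb f.
  by apply/negP => /injectiveP /leq_card; rewrite card_ord ltnn.
have [lt_ij|lt_ji|/val_inj eq_ij] := ltngtP i j.
- by exists i, j; split=> //; exact/red_eq/esym.
- by exists j, i; split=> //; exact/red_eq.
- by rewrite eq_ij eqxx in ij.
Qed.

(** Frobenius is injective modulo [p], so a repetition among the iterated [p]-th powers of [x]
    cancels down to [x ^+ N = x] modulo [p] with [N = p ^ (j - i)]; then [1 - x ^+ N.-1] annihilates
    [x] modulo [p]. *)
Lemma OF_semisimple (x : OF) : exists2 y, pdvd p 1 (y * x) & exists c, y = 1 - x * c.
Proof.
have [i [j [ij hij]]] := OF_pigeonhole x.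
have p0 := prime_gt0 p_pr; have pji : (0 < p ^ (j - i))%N by rewrite expn_gt0 p0.
have hx : pdvd p 1 (x ^+ (p ^ (j - i)) - x).
  have iterfrob k (y : OF) : pdvd p 1 (y ^+ (p ^ k)) -> pdvd p 1 y.
    elim: k => [|k IH]; first by rewrite expn0 expr1.
    by rewrite expnSr exprM => /frob_OF_inj.
  apply: (iterfrob i).
  have frobB k (a b : OF) : pdvd p 1 ((a - b) ^+ (p ^ k) - (a ^+ (p ^ k) - b ^+ (p ^ k))).
    elim: k => [|k IH]; first by rewrite !expn0 !expr1 subrr; apply: pdvd0.
    rewrite expnSr !exprM; apply: pdvd_trans (pdvd_exp _ IH) _.
    exact: pdvd_expB.
  have := frobB i (x ^+ (p ^ (j - i))) x; rewrite -exprM -expnD subnK ?(ltnW ij) // => h.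
  by rewrite -(subrK (x ^+ (p ^ j) - x ^+ (p ^ i)) (_ ^+ (p ^ i))); apply: pdvdD.
exists (1 - x ^+ (p ^ (j - i)).-1).
  by rewrite mulrBl mul1r -exprSr prednK //; apply: pdvd_sym.
have pj1 : (1 < p ^ (j - i))%N.
  by rewrite -{1}(expn0 p) ltn_exp2l ?subn_gt0 ?prime_gt1.
(* The exponent [.-2] is a true subtraction because [j - i] is positive. *)
exists (x ^+ (p ^ (j - i)).-2); rewrite -exprS; congr (_ - _ ^+ _).
by case: (p ^ (j - i))%N pj1 => [|[]].
Qed.

(** This says that [p] generates the maximal ideal after localizing. The annihilator [1 - x * c]
    lies outside the ideal, since otherwise 1 would lie in it. *)
Lemma OF_unramified (P : prime_over F p) (x : OF) : x \in over_ideal P ->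
  exists2 y, y \notin over_ideal P & pdvd p 1 (y * x).
Proof.
move=> xP; have [y yx [c yE]] := OF_semisimple x; exists y => //.
apply/negP => yP; have := idealr1 (over_ideal P).
by rewrite -(subrK (x * c) 1) -yE rpredD // mulrC idealMr.
Qed.

Section FrobeniusElement.
Variable P : prime_over F p.
Local Notation K := {ideal_quot (over_ideal P)}.
Local Notation pi := (\pi_(K)%qT : OF -> K).

Let pi_eq (x y : OF) : pi x = pi y <-> x - y \in over_ideal P.
Proof. by rewrite Quotient.idealrBE; split=> [->|/eqP]. Qed.

Let pdvd_ideal (x : OF) : pdvd p 1 x -> x \in over_ideal P.
Proof. by case=> c ->; rewrite expr1 mulrC idealMr // over_p. Qed.

(** The residue ring [K] is a domain because the ideal is prime, so leading coefficients multiply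
    without vanishing. *)
Let polyK_prod_eq0 (I : Type) (r : seq I) (Q : pred I) (f : I -> {poly K}) :
  \prod_(i <- r | Q i) f i = 0 -> exists2 i, Q i & f i = 0.
Proof.
elim: r => [|i r IH]; first by rewrite big_nil => /eqP; rewrite oner_eq0.
rewrite big_cons; case: ifPn => // Qi fr.
have [f0|f0] := eqVneq (f i) 0; first by exists i.
apply: IH; apply/eqP; apply: contraLR f0 => r0; rewrite negbK.
have := congr1 lead_coef fr; rewrite lead_coef0 => lfr.
have := @Quotient.rquot_IdomainAxiom OF (over_ideal P) (lead_coef (f i))
  (lead_coef (\prod_(j <- r | Q j) f j)).
rewrite !lead_coef_eq0 (negbTE r0) orbF; apply.
by apply: contra_eq lfr => h; rewrite (lead_coef_proper_mul h).
Qed.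

(* With w the generic combination of an integral basis, the product over s of
   X - s(w) has integral coefficients and the root w, so modulo P it also has
   the root obtained from w by raising its coefficients to the power p. *)
Lemma frobenius_element :
  exists s : gal_of {:F}, forall x : OF, gal_OF s x - x ^+ p \in over_ideal P.
Proof.
have [b [bas _]] := dF.
have [||psi psiE] := rmorphism_of (f := fun x : OF => pi (x ^+ p)).
- move=> x y; rewrite -rmorphB; apply/pi_eq/pdvd_ideal; exact: pdvd_expB.
- by split=> [|x y]; rewrite ?expr1n ?rmorph1 // exprMn rmorphM.
pose w : {poly OF} := \sum_i (b i)%:P * 'X^i.
have wE (A : comNzRingType) (f : {rmorphism OF -> A}) (i : 'I_(\dim {:F})) :
    (map_poly f w)`_i = f (b i).
  rewrite coef_map coef_sum (bigD1 i) //= coefCM coefXn eqxx mulr1 big1 ?addr0 //.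
  by move=> j ij; rewrite coefCM coefXn eq_sym (inj_eq val_inj) (negbTE ij) mulr0.
pose g : {poly {poly OF}} := \prod_(s in G) ('X - (map_poly (gal_OF s) w)%:P).
have g_int i j : exists m : int, g`_i`_j = m%:~R.
  apply: gal_fixed_int => t tG.
  suff fixg : map_poly (map_poly (gal_OF t)) g = g by rewrite -[in RHS]fixg !coef_map.
  rewrite /g rmorph_prod [RHS](reindex_inj (mulIg t)) /=.
  apply: eq_big => [s|s sG]; first by rewrite groupMr.
  rewrite rmorphB /= map_polyX map_polyC; congr ('X - _%:P).
  by rewrite /= -map_poly_comp; apply: eq_map_poly => x; rewrite /= gal_OFM.
(* The coefficients of [g] are Galois-invariant, hence integers, and the ring homomorphisms [pi] and
   [psi] agree on integers. *)
have gE : map_poly (map_poly pi) g = map_poly (map_poly psi) g.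
  apply/polyP => i; apply/polyP => j; rewrite !coef_map.
  have [m ->] := g_int i j; rewrite [RHS]rmorph_int; exact: (rmorph_int pi).
have gw : g.[w] = 0.
  rewrite /g horner_prod (bigD1 1%g) ?group1 //= hornerXsubC.
  rewrite (_ : map_poly _ w = w) ?subrr ?mul0r //.
  by apply/polyP => i; rewrite coef_map /= gal_OF1.
have : \prod_(s in G) (map_poly psi w - map_poly (pi \o gal_OF s) w) = 0.
  transitivity (map_poly (map_poly pi) g).[map_poly psi w].
    rewrite /g rmorph_prod horner_prod; apply: eq_bigr => s _.
    rewrite rmorphB /= map_polyX map_polyC hornerXsubC; congr (_ - _).
    by rewrite map_poly_comp.
  by rewrite gE horner_map gw rmorph0.
(* Comparing coefficients in the vanishing factor matches the images of the basis under [s] and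
   under Frobenius; additivity does the rest. *)
case/polyK_prod_eq0 => s sG /eqP; rewrite subr_eq0 => /eqP ws; exists s => x.
apply/pi_eq; rewrite -psiE; have [c [-> _]] := bas x.
rewrite !rmorph_sum; apply: eq_bigr => i _; rewrite !rmorphMz; congr (_ *~ _).
by rewrite -(wE _ psi) ws (wE _ (pi \o gal_OF s)).
Qed.

End FrobeniusElement.

End Unramified.
End IntegersOfF.

(** * Localizations *)

Section LocalizationMaps.
Variables (F : splittingFieldType rat) (p : nat).

Lemma loc_map (s : gal_of {:F}) (P P' : prime_over F p) :
  (forall a, a \notin over_ideal P -> gal_OF s a \notin over_ideal P') ->
  exists f : {rmorphism localization P -> localization P'},
    forall x, val (f x) = s (val x).
Proof.
move=> sP; have in_loc_s (x : localization P) : in_loc P' (s (val x)).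
  have /in_locP[a [t [tP ->]]] := valP x; apply/in_locP.
  by exists (gal_OF s a), (gal_OF s t); split; [exact: sP | rewrite rmorphM fmorphV].
pose f x : localization P' := exist (fun y => in_loc P' y) _ (in_loc_s x).
have [||g hg] := rmorphism_of (f := f); last by exists g => x; rewrite hg.
- by move=> x y; apply: val_inj; rewrite /= rmorphB.
- by split=> [|x y]; apply: val_inj; rewrite /= ?rmorph1 ?rmorphM.
Qed.

Lemma loc_gal (s : gal_of {:F}) (P : prime_over F p) :
  exists (f : {rmorphism localization P -> localization (gal_prime s P)})
         (g : {rmorphism localization (gal_prime s P) -> localization P}),
    [/\ forall x, val (f x) = s (val x), cancel f g & cancel g f].
Proof.
have [|f hf] := @loc_map s P (gal_prime s P).
  by move=> a; rewrite [gal_OF s a \in _]gal_imageE gal_OFK.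
have [|g hg] := @loc_map s^-1%g (gal_prime s P) P.
  by move=> a; rewrite [a \in _]gal_imageE.
exists f, g; split=> // x; apply: val_inj.
  by rewrite hg hf -galM ?memvf // mulgV gal_id.
by rewrite hf hg -galM ?memvf // mulVg gal_id.
Qed.

Lemma loc_torsionfree (P : prime_over F p) : prime p -> torsionfree p (localization P).
Proof.
move=> p_pr x /(congr1 val) /eqP; rewrite rmorphM rmorph_nat rmorph0 /= mulf_eq0.
rewrite -(rmorph_nat (in_alg F)) fmorph_eq0 Num.Theory.pnatr_eq0.
by rewrite eqn0Ngt prime_gt0 //= => /eqP x0; apply: val_inj.
Qed.

Variables (M d : int).
Hypotheses (galF : galois 1 {:F}) (p_pr : prime p).
Hypotheses (dF : is_discriminant F d) (dM : (d %| M)%Z) (pM : ~~ (p%:Z %| M)%Z).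

(** A Frobenius element preserves the ideal and its complement, so it acts on the local ring; its
    inverse supplies [p]-th roots modulo [p]. *)
Lemma loc_frobenius (P : prime_over F p) :
  exists2 phi : {rmorphism localization P -> localization P}, frobenius_lift p phi &
    forall a : localization P, exists b, pdvd p 1 (a - b ^+ p).
Proof.
have [s sE] := frobenius_element galF p_pr dF P.
have X_mem (a : OF F) : (a ^+ p \in over_ideal P) = (a \in over_ideal P).
  suff XS k : (a ^+ k.+1 \in over_ideal P) = (a \in over_ideal P).
    by have := XS p.-1; rewrite prednK ?prime_gt0.
  elim: k => [|k IH]; first by rewrite expr1.
  by rewrite exprS prime_idealrM IH orbb.
have s_mem (a : OF F) : (gal_OF s a \in over_ideal P) = (a \in over_ideal P).
  rewrite -[RHS]X_mem; apply/idP/idP => h.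
    by rewrite -[_ ^+ p](subKr (gal_OF s a)) rpredB // sE.
  by rewrite -[gal_OF s a](subrK (a ^+ p)) rpredD // sE.
have [|phi phiE] := @loc_map s P P; first by move=> a; rewrite s_mem.
have [|phi' phi'E] := @loc_map s^-1%g P P.
  by move=> a aP; rewrite -s_mem gal_OFVK.
have phiF a : pdvd p 1 (phi a - a ^+ p).
  have /in_locP[u [t [tP aE]]] := valP a.
  (* The numerator of [s (u / t) - (u / t) ^+ p]. It lies in the ideal, so a multiplier [y] outside
     the ideal makes it divisible by [p]. *)
  pose x := gal_OF s u * t ^+ p - u ^+ p * gal_OF s t.
  have xP : x \in over_ideal P.
    rewrite (_ : x = t ^+ p * (gal_OF s u - u ^+ p) - u ^+ p * (gal_OF s t - t ^+ p)).
      by rewrite rpredB // idealMr // sE.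
    by rewrite /x; ring.
  have [y yP [c hc]] := OF_unramified galF p_pr dF dM pM xP.
  have tpP : t ^+ p \notin over_ideal P by rewrite X_mem.
  have stP : gal_OF s t \notin over_ideal P by rewrite s_mem.
  pose z := y * (gal_OF s t * t ^+ p).
  have zP : z \notin over_ideal P by rewrite !prime_idealrM !negb_or yP stP tpP.
  have locz : in_loc P (val c / val z) by apply/in_locP; exists c, z.
  exists (exist (fun x => in_loc P x) _ locz); rewrite expr1; apply: val_inj.
  have valX : p%:R * val c =
      val y * (s (val u) * val t ^+ p - val u ^+ p * s (val t)).
    have := congr1 val hc; rewrite expr1 !rmorphM rmorph_nat => <-.
    by rewrite /x rmorphB !rmorphM !rmorphXn.
  have valZ : val z = val y * (s (val t) * val t ^+ p) by rewrite !rmorphM rmorphXn.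
  transitivity (s (val u) / s (val t) - (val u / val t) ^+ p).
    have <- : s (val u / val t) = s (val u) / s (val t) by exact: fmorph_div.
    by rewrite -aE -phiE rmorphB rmorphXn.
  transitivity (p%:R * (val c / val z)); last by rewrite [RHS]rmorphM rmorph_nat.
  rewrite mulrA valX valZ expr_div_n.
  have tp0 : val t ^+ p != 0 by rewrite expf_neq0 // (notin_neq0 tP).
  have st0 : s (val t) != 0 := notin_neq0 stP.
  have y0 := notin_neq0 yP.
  move: (val t ^+ p) (val u ^+ p) (s (val t)) (s (val u)) (val y) tp0 st0 y0.
  by move=> tp up st su v tp0 st0 v0; field; rewrite tp0 st0 v0.
exists phi; first exact/frobenius_liftP.
move=> a; exists (phi' a); have aE : phi (phi' a) = a.
  by apply: val_inj; rewrite phiE phi'E -galM ?memvf // mulVg gal_id.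
by rewrite -{1}aE; apply: phiF.
Qed.

Lemma Rhat_complete (P : prime_over F p) : complete p (Rhat P).
Proof. exact: completion_complete. Qed.

Lemma Rhat_frobenius (P : prime_over F p) :
  exists2 phi : {rmorphism Rhat P -> Rhat P}, frobenius_lift p phi &
    forall phi' : {rmorphism Rhat P -> Rhat P}, frobenius_lift p phi' -> phi' =1 phi.
Proof.
have [phi0 /frobenius_liftP phi0F perf] := loc_frobenius P.
pose iota := to_completion (@localization_nonunit F p P).
have [phi hphi] := completion_lift (@localization_nonunit F p P)
  (iota \o phi0 : {rmorphism _ -> _}) (Rhat_complete P).
have phiF : frobenius_lift p phi.
  apply/frobenius_liftP => a; have [b hb] := completion_dense a 1.
  apply: (@pdvd_trans _ _ _ _ (phi (iota b))); first by rewrite -rmorphB; apply: pdvd_rmorph.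
  apply: (@pdvd_trans _ _ _ _ (iota b ^+ p)); last exact/pdvd_exp/pdvd_sym.
  by rewrite hphi /= -rmorphXn -rmorphB; apply: pdvd_rmorph.
exists phi => // phi' phi'F; apply: (frobenius_lift_unique p_pr) => //.
  exact: (proj1 (Rhat_complete P)).
move=> a; have [b hb] := completion_dense a 1; have [c hc] := perf b.
exists (iota c); apply: pdvd_trans hb _.
by rewrite -rmorphXn -rmorphB; apply: pdvd_rmorph.
Qed.

End LocalizationMaps.

(** * Connections at one prime *)

Lemma to_loc_mx_unit (F : splittingFieldType rat) (p : nat) (P : prime_over F p)
    (M : int) m (q : 'M[F]_m) :
  prime p -> ~~ (p%:Z %| M)%Z -> GL_OFM M q ->
  exists w : 'M[localization P]_m,
    map_mx (to_loc P) q *m w = 1%:M /\ w *m map_mx (to_loc P) q = 1%:M.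
Proof.
move=> p_pr pM [qM [r [rM qr rq]]].
have toK (u : 'M[F]_m) : (forall i j, in_OFM M (u i j)) ->
    map_mx (val : localization P -> F) (map_mx (to_loc P) u) = u.
  by move=> uM; apply/matrixP => i j; rewrite !mxE (to_locK P p_pr pM).
have val_mx_inj (u v : 'M[localization P]_m) :
    map_mx (val : localization P -> F) u = map_mx val v -> u = v.
  move=> uv; apply/matrixP => i j; apply: val_inj.
  by move/matrixP/(_ i j): uv; rewrite !mxE.
by exists (map_mx (to_loc P) r); split; apply: val_mx_inj;
  rewrite map_mxM !toK // ?qr ?rq map_mx1.
Qed.

Lemma mx_inverse (B : comNzRingType) m (A : 'M[B]_m) h : \det A * h = 1 ->
  exists V, A *m V = 1%:M /\ V *m A = 1%:M.
Proof.
move=> Ah; exists (h *: \adj A); split.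
  by rewrite -scalemxAr mul_mx_adj scale_scalar_mx mulrC Ah.
by rewrite -scalemxAl mul_adj_mx scale_scalar_mx mulrC Ah.
Qed.

(** This makes x^T q x an admissible image of x, so that the homomorphism H_q exists. *)
Lemma det_congruence_unit (B : comNzRingType) m (X A W : 'M[B]_m) h :
  \det X * h = 1 -> A *m W = 1%:M -> exists h', \det (X^T *m A *m X) * h' = 1.
Proof.
move=> Xh /(congr1 (fun A => \det A)); rewrite det_mulmx det1 => AW.
exists (h * \det W * h); rewrite !det_mulmx det_tr.
transitivity ((\det X * h) * (\det X * h) * (\det A * \det W)); first by ring.
by rewrite Xh AW !mulr1.
Qed.

Section OneConnection.
Variables (F : splittingFieldType rat) (p : nat) (M d : int).
Hypotheses (galF : galois 1 {:F}) (p_pr : prime p).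
Hypotheses (dF : is_discriminant F d) (dM : (d %| M)%Z) (pM : ~~ (p%:Z %| M)%Z).
Variables (m : nat) (q : 'M[F]_m).
Hypotheses (qM : GL_OFM M q) (qsym : q^T = q).

Lemma Ohat_complete (P : prime_over F p) : complete p (Ohat P m).
Proof. exact: completion_complete. Qed.

Lemma Ohat_torsionfree (P : prime_over F p) : torsionfree p (Ohat P m).
Proof.
apply: completion_torsionfree; apply: GL_ring_torsionfree.
by apply: completion_torsionfree; apply: loc_torsionfree.
Qed.

Lemma Rhat_to_Ohat_morphism (P : prime_over F p) :
  exists c : {rmorphism Rhat P -> Ohat P m}, c =1 @Rhat_to_Ohat F p P m.
Proof.
have [c hc] := GL_const_morphism (Rhat P) m.
exists (to_completion _ \o c : {rmorphism _ -> _}) => a.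
by rewrite /= hc.
Qed.

(** Constants need only be compared on the localization, which is dense in [Rhat P]. *)
Lemma Ohat_hom_eq (P : prime_over F p) (B : comNzRingType)
    (f g : {rmorphism Ohat P m -> B}) : separated p B ->
  (forall a, f (loc_to_Ohat m a) = g (loc_to_Ohat m a)) ->
  map_mx f (xmx P m) = map_mx g (xmx P m) -> f =1 g.
Proof.
move=> sep fgC fgX; apply: GLhat_hom_eq fgX => // r.
have [c hc] := Rhat_to_Ohat_morphism P.
have := @completion_hom_eq _ _ _ _ (f \o c : {rmorphism _ -> _})
  (g \o c : {rmorphism _ -> _}) sep.
move/(_ _ r); rewrite /= hc; apply => a.
by rewrite /= !hc; apply: fgC.
Qed.

(** Both maps come from universal properties, and the composites are the identity because they fix
    the localization and the coordinates. *)
Lemma gal_ext_exists (P : prime_over F p) (s : gal_of {:F}) :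
  exists (S : {rmorphism Ohat P m -> Ohat (gal_prime s P) m})
         (T : {rmorphism Ohat (gal_prime s P) m -> Ohat P m}),
    [/\ is_gal_ext S, cancel S T, cancel T S
      & map_mx T (xmx (gal_prime s P) m) = xmx P m].
Proof.
have [f [g [fE fK gK]]] := loc_gal s P.
have ext (P1 P2 : prime_over F p) (h : {rmorphism localization P1 -> localization P2}) :
  exists S : {rmorphism Ohat P1 m -> Ohat P2 m},
    (forall a, S (loc_to_Ohat m a) = loc_to_Ohat m (h a)) /\
    map_mx S (xmx P1 m) = xmx P2 m.
  have [c hc] := Rhat_to_Ohat_morphism P2.
  pose h2 : {rmorphism localization P1 -> Ohat P2 m} :=
    c \o (to_completion (@localization_nonunit F p P2) \o h).
  have [h3 h3E] := completion_lift (@localization_nonunit F p P1) h2 (Ohat_complete P2).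
  have [u hu] := GLhat_mx_unit m (@Rhat_nonunit F p P2).
  have [S [SC SX]] := GLhat_lift (@Rhat_nonunit F p P1) h3 (Ohat_complete P2) hu.
  exists S; split=> // a; rewrite /loc_to_Ohat [S _]SC h3E; exact: hc.
have [S [SC SX]] := ext _ _ f; have [T [TC TX]] := ext _ _ g.
exists S, T; split; last exact: TX.
- split; last exact: SX.
  move=> a b ab; rewrite SC; congr (loc_to_Ohat m _).
  by apply: val_inj; rewrite fE ab.
- apply: (@Ohat_hom_eq _ _ (T \o S : {rmorphism _ -> _}) idfun).
  + exact: (proj1 (Ohat_complete P)).
  + by move=> a; rewrite /= SC TC fK.
  + by rewrite map_mx_comp SX TX map_mx_id.
- apply: (@Ohat_hom_eq _ _ (S \o T : {rmorphism _ -> _}) idfun).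
  + exact: (proj1 (Ohat_complete _)).
  + by move=> a; rewrite /= TC SC gK.
  + by rewrite map_mx_comp TX SX map_mx_id.
Qed.

Variable P : prime_over F p.
Local Notation O := (Ohat P m).
Local Notation x := (xmx P m).
Local Notation Y := (mx_frob p x).

Lemma frob_x_inverse : exists V, Y *m V = 1%:M /\ V *m Y = 1%:M.
Proof.
have [h hx] := GLhat_mx_unit m (@Rhat_nonunit F p P).
have [|h' hY] := det_frob_unit (Y := Y) p_pr (Ohat_complete P) hx.
  by move=> i j; rewrite mxE subrr; apply: pdvd0.
exact: mx_inverse hY.
Qed.

(** Any [D] is allowed: [Y + p%:R *: D] is invertible because it agrees with x^(p) modulo [p]. *)
Lemma phi_exists (phiR : {rmorphism Rhat P -> Rhat P}) (D : 'M[O]_m) :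
  frobenius_lift p phiR ->
  exists phi : {rmorphism O -> O}, [/\ frobenius_lift p phi,
    forall a, phi (Rhat_to_Ohat m a) = Rhat_to_Ohat m (phiR a)
    & map_mx phi x = Y + p%:R *: D].
Proof.
move=> /frobenius_liftP phiRF.
have [c hc] := Rhat_to_Ohat_morphism P.
have [h hx] := GLhat_mx_unit m (@Rhat_nonunit F p P).
have near i j : pdvd p 1 ((Y + p%:R *: D) i j - x i j ^+ p).
  by rewrite mxE [Y i j]mxE addrAC subrr add0r mxE; apply: pdvd1I.
have [h' hY] := det_frob_unit p_pr (Ohat_complete P) hx near.
have [phi [phiC phiX]] := GLhat_lift (@Rhat_nonunit F p P)
  (c \o phiR : {rmorphism _ -> _}) (Ohat_complete P) hY.
have phiC' a : phi (Rhat_to_Ohat m a) = Rhat_to_Ohat m (phiR a).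
  by rewrite [phi _]phiC /= hc.
exists phi; split=> //; apply: GLhat_frobenius => //.
  move=> r; rewrite [phi _]phiC' -[to_completion _ _]/(Rhat_to_Ohat m r).
  by rewrite -!hc -rmorphXn -rmorphB; apply: pdvd_rmorph.
by move=> i j; have := near i j; rewrite -phiX mxE.
Qed.

(** A connection extends some [p]-derivation of [Rhat P]; uniqueness of the Frobenius lift
    identifies it. *)
Lemma padic_connection_frobenius (delta : O -> O)
    (phiR : {rmorphism Rhat P -> Rhat P}) : frobenius_lift p phiR ->
  padic_connection delta ->
  forall a, attached p delta (Rhat_to_Ohat m a) = Rhat_to_Ohat m (phiR a).
Proof.
move=> phiRF [_ [delta0 [[phi' phi'E] hd]]] a.
have [c hc] := Rhat_to_Ohat_morphism P.
have [psi _ psi_uniq] := Rhat_frobenius galF p_pr dF dM pM P.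
rewrite (psi_uniq _ phiRF) -(psi_uniq phi'); last exact: p_derivation_frobenius phi'E.
by rewrite /attached hd -!hc phi'E rmorphD rmorphM rmorphXn rmorph_nat.
Qed.

Lemma padic_connection_eq (delta delta' : O -> O) :
  padic_connection delta -> padic_connection delta' ->
  map_mx delta x = map_mx delta' x -> delta = delta'.
Proof.
move=> hd hd' xx; have [phiR phiRF _] := Rhat_frobenius galF p_pr dF dM pM P.
have hC := padic_connection_frobenius phiRF hd.
have hC' := padic_connection_frobenius phiRF hd'.
have [[phi phiE] _] := hd; have [[phi' phi'E] _] := hd'.
have e : phi =1 phi'.
  apply: Ohat_hom_eq; first exact: (proj1 (Ohat_complete P)).
    by move=> a; rewrite phiE phi'E hC hC'.
  apply/matrixP => i j; move/matrixP/(_ i j): xx; rewrite !mxE phiE phi'E.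
  by rewrite /attached => ->.
have tf : torsionfree p O by exact: Ohat_torsionfree.
apply: funext => a; have := e a; rewrite phiE phi'E.
by move=> /addrI /(torsionfree_mulI tf).
Qed.

(* Q is phi(q), which depends only on the Frobenius lift of Rhat, and C is the
   defect ((x^T q x)^(p) - (x^(p))^T phi(q) x^(p)) / p. *)
Lemma connection_equations : exists Q W C : 'M[O]_m,
  [/\ [/\ Q *m W = 1%:M, W *m Q = 1%:M, Q^T = Q & C^T = C],
      forall D, exists2 delta : O -> O, padic_connection delta & map_mx delta x = D
    & forall delta, padic_connection delta ->
        map_mx (attached p delta) (qmx P q) = Q /\
        (metric q delta <->
          (Y + p%:R *: map_mx delta x)^T *m Q *m (Y + p%:R *: map_mx delta x) =
          Y^T *m Q *m Y + p%:R *: C)].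
Proof.
have tf : torsionfree p O by exact: Ohat_torsionfree.
have [phiR phiRF _] := Rhat_frobenius galF p_pr dF dM pM P.
have [c hc] := Rhat_to_Ohat_morphism P.
pose iota := to_completion (@localization_nonunit F p P).
pose Q : 'M[O]_m := map_mx c (map_mx phiR (map_mx iota (map_mx (to_loc P) q))).
have qmxE : qmx P q = map_mx c (map_mx iota (map_mx (to_loc P) q)).
  by apply/matrixP => i j; rewrite !mxE hc.
have [w [qw wq]] := to_loc_mx_unit P p_pr pM qM.
pose W : 'M[O]_m := map_mx c (map_mx phiR (map_mx iota w)).
have [phi0 [phi0F phi0C phi0X]] := phi_exists 0 phiRF.
rewrite scaler0 addr0 in phi0X.
have phiq (f : {rmorphism O -> O}) :
    (forall a, f (Rhat_to_Ohat m a) = Rhat_to_Ohat m (phiR a)) ->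
    map_mx f (qmx P q) = Q.
  by move=> hf; rewrite qmxE; apply/matrixP => i j; rewrite !mxE !hc hf.
have qmxsym : (qmx P q)^T = qmx P q by rewrite /qmx map_trmx qsym.
have Qsym : Q^T = Q by rewrite /Q !map_trmx qsym.
have phiH (f : {rmorphism O -> O}) :
    (forall a, f (Rhat_to_Ohat m a) = Rhat_to_Ohat m (phiR a)) ->
    map_mx f (x^T *m qmx P q *m x) = (map_mx f x)^T *m Q *m map_mx f x.
  by move=> hf; rewrite !map_mxM -map_trmx phiq.
(* The lift [phi0], the case [D = 0], sends x^T q x to [Y^T *m Q *m Y] and agrees modulo [p] with
   raising its entries to the power [p]. *)
have [C CE] : exists C : 'M[O]_m,
    mx_frob p (x^T *m qmx P q *m x) = Y^T *m Q *m Y + p%:R *: C.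
  have [u hu] := choice phi0F.
  exists (- map_mx u (x^T *m qmx P q *m x)); rewrite -phi0X -phiH //.
  by apply/matrixP => i j; rewrite !mxE hu mulrN addrK.
have Csym : C^T = C.
  pose Z := mx_frob p (x^T *m qmx P q *m x) - Y^T *m Q *m Y.
  have pC : p%:R *: C = Z by rewrite /Z CE addrC addKr.
  have sym2 (A X : 'M[O]_m) : A^T = A -> (X^T *m A *m X)^T = X^T *m A *m X.
    by move=> AT; rewrite !trmx_mul AT trmxK mulmxA.
  have ZT : Z^T = Z.
    by rewrite /Z linearB /= (sym2 Q Y Qsym) /mx_frob map_trmx (sym2 _ _ qmxsym).
  apply/matrixP => i j; apply: (torsionfree_mulI tf); rewrite mxE.
  have pCij k l : p%:R * C k l = Z k l by rewrite -pC mxE.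
  by rewrite !pCij -[in RHS]ZT [RHS]mxE.
exists Q, W, C; split.
- by split=> //; rewrite /Q /W -!map_mxM ?qw ?wq !map_mx1.
- move=> D; have [phi [phiF phiC phiX]] := phi_exists D phiRF.
  have [delta deltaE] := p_derivation_exists phiF.
  have [delta0 delta0E] := p_derivation_exists phiRF.
  exists delta.
    split; first by exists phi.
    exists delta0; split; first by exists phiR.
    move=> a; apply: (torsionfree_mulI tf); apply: (addrI (Rhat_to_Ohat m a ^+ p)).
    rewrite -[LHS]deltaE phiC -!hc delta0E /attached.
    by rewrite rmorphD rmorphM rmorphXn rmorph_nat.
  apply/matrixP => i j; apply: (torsionfree_mulI tf); apply: (addrI (x i j ^+ p)).
  move/matrixP/(_ i j): phiX; rewrite !mxE deltaE; exact.
move=> delta hd; have hC := padic_connection_frobenius phiRF hd.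
have [[phi phiE] _] := hd.
have phiC a : phi (Rhat_to_Ohat m a) = Rhat_to_Ohat m (phiR a) by rewrite phiE hC.
have phiX : map_mx phi x = Y + p%:R *: map_mx delta x.
  by apply/matrixP => i j; rewrite !mxE phiE.
split.
  by rewrite -(phiq phi phiC); apply/matrixP => i j; rewrite [LHS]mxE [RHS]mxE phiE.
(* The metric identity compares two ring homomorphisms that agree on constants, so it amounts to
   their equality on x. *)
rewrite -CE -phiX -(phiH phi phiC); split=> [[H [psi [[HC HX] [_ _ psiX] Hpsi]]]|hX].
  rewrite -HX; apply/matrixP => i j; rewrite !mxE phiE Hpsi.
  by move/matrixP/(_ i j): psiX; rewrite !mxE => ->; rewrite rmorphXn.
have [hq hqE] : exists h, \det (x^T *m qmx P q *m x) * h = 1.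
  have [h hx] := GLhat_mx_unit m (@Rhat_nonunit F p P).
  apply: (det_congruence_unit (W := map_mx c (map_mx iota w)) hx).
  by rewrite qmxE -!map_mxM qw !map_mx1.
have [H [HC HX]] := GLhat_lift (@Rhat_nonunit F p P) c (Ohat_complete P) hqE.
have HC' a : H (Rhat_to_Ohat m a) = Rhat_to_Ohat m a by rewrite [H _]HC hc.
exists H, phi0; split.
- by split.
- split; [exact: phi0F| |exact: phi0X].
  by exists phiR; split; [exact: phiRF|exact: phi0C].
move=> f; rewrite -phiE.
have hom := @Ohat_hom_eq P O (phi \o H : {rmorphism _ -> _}) (H \o phi0 : {rmorphism _ -> _}).
apply: (hom (proj1 (Ohat_complete P))) => [a|].
  by rewrite /= /loc_to_Ohat HC' phiC phi0C HC'.
have HX' : map_mx H x = x^T *m qmx P q *m x := HX.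
rewrite (map_mx_comp H phi) (map_mx_comp phi0 H) phi0X HX' hX -HX'.
apply/matrixP => i j; rewrite [LHS]mxE [RHS]mxE [(mx_frob p x) i j]mxE rmorphXn.
by congr (_ ^+ p); rewrite mxE.
Qed.

End OneConnection.

(** * Existence and uniqueness *)

Lemma map_mx_trmulmx (A B : comNzRingType) (f : {rmorphism A -> B}) m (X Q Z : 'M[A]_m) :
  map_mx f (X^T *m Q *m Z) = (map_mx f X)^T *m map_mx f Q *m map_mx f Z.
Proof. by rewrite !map_mxM map_trmx. Qed.

Lemma map_mx_addp (A B : comNzRingType) (f : {rmorphism A -> B}) m p (X Z : 'M[A]_m) :
  map_mx f (X + p%:R *: Z) = map_mx f X + p%:R *: map_mx f Z.
Proof. by rewrite map_mxD map_mxZ rmorph_nat. Qed.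

Lemma map_mx_injective (A B : comNzRingType) (f : A -> B) m :
  injective f -> injective (map_mx f : 'M[A]_m -> 'M[B]_m).
Proof.
move=> f_inj X Z XZ; apply/matrixP => i j; apply: f_inj.
by move/matrixP/(_ i j): XZ; rewrite !mxE.
Qed.

Lemma metric_transport (A B : comNzRingType) (f : {rmorphism A -> B}) m p
    (Y D Q C : 'M[A]_m) (Y' : 'M[B]_m) : injective f -> map_mx f Y = Y' ->
  (Y + p%:R *: D)^T *m Q *m (Y + p%:R *: D) = Y^T *m Q *m Y + p%:R *: C <->
  (Y' + p%:R *: map_mx f D)^T *m map_mx f Q *m (Y' + p%:R *: map_mx f D) =
  Y'^T *m map_mx f Q *m Y' + p%:R *: map_mx f C.
Proof.
move=> f_inj <-; rewrite -!map_mx_addp -!map_mx_trmulmx -map_mx_addp.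
by split=> [->|/(map_mx_injective f_inj)].
Qed.

Lemma half_exists (p : nat) (B : comNzRingType) : complete p B -> odd p ->
  exists h : B, 2%:R * h = 1.
Proof.
(* The integer [(p + 1) / 2] inverts 2 modulo [p]. *)
move=> cB p_odd; have [|u hu] := @complete_unit p B (2%:R * (p.+1)./2%:R) cB.
  rewrite -natrM mul2n even_halfK /= ?negbK // -natr1 addrK.
  by rewrite -[p%:R]mulr1; apply: pdvd1I.
by exists ((p.+1)./2%:R * u); rewrite mulrA.
Qed.

Theorem theorem2p10 (F : splittingFieldType rat) (M d : int) (n : nat)
    (sigma : 'I_n.+1 -> gal_of {:F}) (p : nat) (P : prime_over F p)
    (q : 'M[F]_n.+1) :
  galois 1 {:F} ->
  (2 %| M)%Z -> is_discriminant F d -> (d %| M)%Z ->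
  (forall i, sigma i \in 'Gal({:F} / 1)%g) -> sigma ord0 = 1%g ->
  prime p -> ~~ (p%:Z %| M)%Z ->
  GL_OFM M q -> q^T = q ->
  exists! delta : (forall i, Ohat (gal_prime (sigma i) P) n.+1 ->
                             Ohat (gal_prime (sigma i) P) n.+1),
    [/\ vertical_connection delta,
        forall i, metric q (delta i)
      & torsion_free q delta].
Proof.
move=> galF M2 dF dM _ _ p_pr pM qM qsym.
have p_odd : odd p.
  by case: (even_prime p_pr) => // p2; rewrite p2 M2 in pM.
pose m := n.+1; pose O := Ohat P m; pose O_ i := Ohat (gal_prime (sigma i) P) m.
have cO : complete p O := Ohat_complete m P.
have tfO : torsionfree p O by exact: Ohat_torsionfree.
have [half halfP] := half_exists cO p_odd.
have [V [YV VY]] := frob_x_inverse p_pr m P.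
pose ext i := cid (gal_ext_exists m P (sigma i)).
pose S i : {rmorphism O -> O_ i} := sval (ext i).
pose ext' i := cid (svalP (ext i)).
pose T i : {rmorphism O_ i -> O} := sval (ext' i).
have STP i : [/\ is_gal_ext (S i), cancel (S i) (T i), cancel (T i) (S i)
  & map_mx (T i) (xmx (gal_prime (sigma i) P) m) = xmx P m] := svalP (ext' i).
have T_inj i : injective (T i) by have [_ _ TK _] := STP i; apply: can_inj TK.
have TY i : map_mx (T i) (mx_frob p (xmx (gal_prime (sigma i) P) m)) =
    mx_frob p (xmx P m).
  have [_ _ _ <-] := STP i.
  by apply/matrixP => j k; rewrite !mxE rmorphXn.
pose eqs i := cid (connection_equations galF p_pr dF dM pM qM qsym
  (gal_prime (sigma i) P)).
pose Q i := sval (eqs i); pose eqs1 i := cid (svalP (eqs i)).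
pose W i := sval (eqs1 i); pose eqs2 i := cid (svalP (eqs1 i)).
pose C i := sval (eqs2 i).
have eqsP i := svalP (eqs2 i).
pose D (delta : forall i, O_ i -> O_ i) i : 'M[O]_m :=
  map_mx (T i) (map_mx (delta i) (xmx (gal_prime (sigma i) P) m)).
pose LC := levi_civita p (mx_frob p (xmx P m)) (fun i => map_mx (T i) (Q i))
  (fun i => map_mx (T i) (C i)).
have metricP delta : vertical_connection delta ->
    (forall i, metric q (delta i)) <->
    (forall i, (mx_frob p (xmx P m) + p%:R *: D delta i)^T *m map_mx (T i) (Q i) *m
      (mx_frob p (xmx P m) + p%:R *: D delta i) =
      (mx_frob p (xmx P m))^T *m map_mx (T i) (Q i) *m mx_frob p (xmx P m) +
      p%:R *: map_mx (T i) (C i)).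
  move=> vd.
  have mP i : metric q (delta i) <-> _ :=
    iff_trans (proj2 (let: And3 _ _ h := eqsP i in h _ (vd i)))
      (metric_transport p (map_mx (delta i) (xmx (gal_prime (sigma i) P) m))
        (Q i) (C i) (T_inj i) (TY i)).
  by split=> h i; apply/mP; apply: h.
have chrE delta i j k : vertical_connection delta ->
    T i (christoffel q (delta i) j k) =
    ((D delta i)^T *m map_mx (T i) (Q i) *m mx_frob p (xmx P m)) j k.
  move=> vd; have [_ _ /(_ _ (vd i)) [QE _]] := eqsP i.
  by rewrite /christoffel QE -(TY i) -map_mx_trmulmx [RHS]mxE.
have torsionP delta : vertical_connection delta ->
    torsion_free q delta <->
    (forall i j k,
      ((D delta i)^T *m map_mx (T i) (Q i) *m mx_frob p (xmx P m)) j k =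
      ((D delta j)^T *m map_mx (T j) (Q j) *m mx_frob p (xmx P m)) i k).
  move=> vd; split=> [[T' [T'P h]] i j k|h].
    (* Torsion-freeness only asserts that some transport maps exist; the Galois extension fixing the
       coordinates is unique, so they are the chosen [T]. *)
    have T'E l : T' l =1 T l.
      have [S' [[S'C S'X] S'K T'K]] := T'P l.
      have [[SC SX] SK TK _] := STP l.
      have SS : S' =1 S l.
        apply: Ohat_hom_eq => [|a|]; last by rewrite S'X SX.
          exact: (proj1 (Ohat_complete _ _)).
        have [f [_ [fE _ _]]] := loc_gal (sigma l) P.
        by rewrite (S'C a (f a)) // (SC a (f a)).
      by move=> y; rewrite -{1}(TK y) -SS S'K.
    by rewrite -!chrE // -!T'E.
  exists (fun i => T i); split=> [i|i j k]; last by rewrite !chrE.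
  by exists (S i); have [] := STP i.
have LCP delta : vertical_connection delta ->
    (forall i, metric q (delta i)) /\ torsion_free q delta <-> LC (D delta).
  by move=> vd; split=> -[/(metricP _ vd) h1 /(torsionP _ vd) h2].
have QW i : map_mx (T i) (Q i) *m map_mx (T i) (W i) = 1%:M.
  by have [[QW _ _ _] _ _] := eqsP i; rewrite -map_mxM QW map_mx1.
have WQ i : map_mx (T i) (W i) *m map_mx (T i) (Q i) = 1%:M.
  by have [[_ WQ _ _] _ _] := eqsP i; rewrite -map_mxM WQ map_mx1.
have Qsym i : (map_mx (T i) (Q i))^T = map_mx (T i) (Q i).
  by have [[_ _ Qs _] _ _] := eqsP i; rewrite map_trmx Qs.
have Csym i : (map_mx (T i) (C i))^T = map_mx (T i) (C i).
  by have [[_ _ _ Cs] _ _] := eqsP i; rewrite map_trmx Cs.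
have [D0 D0P] := levi_civita_exists cO tfO halfP YV VY QW WQ Qsym Csym.
(* Each matrix of the solution is carried back to its own prime, where a connection with that matrix
   exists. *)
pose del i := cid2 (let: And3 _ h _ := eqsP i in h (map_mx (S i) (D0 i))).
pose delta i := s2val (del i).
have vd : vertical_connection delta by move=> i; apply: (s2valP (del i)).
have DE : D delta = D0.
  apply: funext => i; rewrite /D (s2valP' (del i)).
  have [_ SK _ _] := STP i.
  by apply/matrixP => j k; rewrite !mxE SK.
exists delta; split; first by have [] := proj2 (LCP _ vd); rewrite ?DE.
move=> delta' [vd' md' td'].
have LC' : LC (D delta') by apply/LCP.
have DD : D delta = D delta'.
  by rewrite DE; apply: (levi_civita_unique cO tfO halfP YV QW Qsym Csym D0P LC').
(* A connection is determined by its matrix, which can be compared after the injective transport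
   [T i]. *)
apply: functional_extensionality_dep => i.
apply: (padic_connection_eq galF p_pr dF dM pM) => //.
by apply: (map_mx_injective (T_inj i)); have := congr1 (fun f => f i) DD.
Qed.
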